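(* Let $X$ and $Y$ be two superreflexive real Banach spaces. Then the following are equivalent: (1) the projective tensor product $X\widehat{\otimes}_\pi Y$ is superreflexive; (2) either $X$ or $Y$ is finite-dimensional.
   Context: All Banach spaces are real. Finite representability: a Banach space $W$ is finitely representable in a Banach space $V$ if for every finite-dimensional subspace $E$ of $W$ and every $\varepsilon>0$ there exist a finite-dimensional subspace $F$ of $V$ and a linear bijection $T:E\to F$ with $\|T\|\,\|T^{-1}\|\le 1+\varepsilon$. Superreflexivity: a Banach space $V$ is superreflexive if every Banach space $W$ which is finitely representable in $V$ is reflexive. Projective tensor product: $X\widehat{\otimes}_\pi Y$ is the completion of the algebraic tensor product $X\otimes Y$ with respect to the norm $\|z\|_\pi=\inf\left\{\sum_{n=1}^k\|x_n\|\,\|y_n\| : z=\sum_{n=1}^k x_n\otimes y_n\right\}$, where the infimum is over all finite representations of $z$ with $x_n\in X$, $y_n\in Y$. *)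

(* Defs.v *)
From HB Require Import structures.
From mathcomp Require Import all_boot all_order all_algebra.
From mathcomp Require Import ring_quotient.
From mathcomp Require Import all_classical all_reals all_analysis.
From mathcomp Require Import ring lra.

Set Implicit Arguments.
Unset Strict Implicit.
Unset Printing Implicit Defensive.

Import Order.TTheory GRing.Theory Num.Theory.
Import numFieldNormedType.Exports.

Local Open Scope classical_set_scope.
Local Open Scope ring_scope.

(* The operator norm of the restriction of f to a subspace E. [sup] of an
   unbounded set is 0, but below f is always bounded on E: either it is
   continuous, or E is finite-dimensional. *)
Definition opnorm (R : realType) (V W : normedModType R) (E : set V)
    (f : V -> W) : R :=
  sup [set `|f x| | x in E `&` [set x | `|x| <= 1]].

(* The topological dual with the operator norm, as a normed space. *)
Section dual.
Context (R : realType) (V : normedModType R).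

Definition dual_pred : {pred V -> R^o} :=
  mem [set f : V -> R^o | linear f /\ continuous f].

Record dual_space := Dual { dual_fun :> V -> R^o; dual_funP : dual_fun \in dual_pred }.
HB.instance Definition _ := [isSub for dual_fun].
HB.instance Definition _ := [Choice of dual_space by <:].

Let dual_submod_closed : submod_closed dual_pred.
Proof.
split=> [|a f g].
  rewrite inE; split=> [a x y|x]; first by rewrite scaler0 addr0.
  exact: cvg_cst.
rewrite !inE => -[fl fc] [gl gc]; split=> [b x y|x].
  change (a * f (b *: x + y) + g (b *: x + y) =
    b * (a * f x + g x) + (a * f y + g y)).
  have -> : f (b *: x + y) = b * f x + f y by exact: fl.
  have -> : g (b *: x + y) = b * g x + g y by exact: gl.
  by ring.
apply: (@cvgD _ _ _ _ _ (a \*: f) g); last exact: gc.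
by apply: cvgZr; exact: fc.
Qed.
HB.instance Definition _ := GRing.isSubmodClosed.Build R (V -> R^o) dual_pred
  dual_submod_closed.
HB.instance Definition _ := [SubChoice_isSubLmodule of dual_space by <:].

Let dual_has_sup (f : dual_space) :
  has_sup [set `|f x| | x in setT `&` [set x : V | `|x| <= 1]].
Proof.
have [fl fc] := set_mem (dual_funP f).
pose ml := GRing.isLinear.Build R V R^o *:%R f fl.
pose g : {linear V -> R^o} := HB.pack (f : V -> R^o) ml.
split; first by exists `|f 0|, 0 => //; split => //=; rewrite normr0.
have /linear_bounded_continuous/bounded_funP/(_ 1)[M hM] : continuous g by [].
by exists M => _ [x [_ x1] <-]; exact: (hM x).
Qed.

Let dualZ (f : dual_space) a x : f (a *: x) = a * f x.
Proof.
have [fl fc] := set_mem (dual_funP f).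
pose ml := GRing.isLinear.Build R V R^o *:%R f fl.
pose g : {linear V -> R^o} := HB.pack (f : V -> R^o) ml.
exact: (linearZ_LR g).
Qed.

Let normf (f : dual_space) : R := opnorm setT f.

Let normf_ub (f : dual_space) x : `|x| <= 1 -> `|f x| <= normf f.
Proof. by move=> x1; apply: ub_le_sup; [case: (dual_has_sup f)|exists x]. Qed.

Let normf_le (f : dual_space) M : (forall x, `|x| <= 1 -> `|f x| <= M) -> normf f <= M.
Proof.
move=> H; apply: ge_sup; first by case: (dual_has_sup f).
by move=> _ [x [_ x1] <-]; exact: H.
Qed.

Let normfD f g : normf (f + g) <= normf f + normf g.
Proof.
apply: normf_le => x x1.
have -> : (f + g) x = f x + g x by [].
by rewrite (le_trans (ler_normD _ _))// lerD// normf_ub.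
Qed.

Let normfZle a f : normf (a *: f) <= `|a| * normf f.
Proof.
apply: normf_le => x x1.
have -> : (a *: f) x = a * f x by [].
by rewrite normrM ler_wpM2l// normf_ub.
Qed.

Let normf_ge0 f : 0 <= normf f.
Proof. by apply: le_trans (normf_ub f (x := 0) _); rewrite ?normr0. Qed.

Let normfZ a f : normf (a *: f) = `|a| * normf f.
Proof.
apply/eqP; rewrite eq_le normfZle/=.
have [->|a0] := eqVneq a 0; first by rewrite normr0 mul0r normf_ge0.
rewrite -ler_pdivlMl ?normr_gt0// -normfV.
by rewrite -{1}[f]scale1r -(mulVf a0) -scalerA normfZle.
Qed.

Let normf0_eq0 f : normf f = 0 -> f = 0.
Proof.
move=> f0; apply: val_inj; apply/funext => x /=.
have [->|x0] := eqVneq x 0.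
  by have := dualZ f 0 0; rewrite scale0r mul0r.
have n0 : `|x| != 0 by rewrite normr_eq0.
have /(normf_ub f) : `|(`|x|)^-1 *: x| <= 1.
  by rewrite normrZ normfV normr_id mulVf.
rewrite f0 dualZ normr_le0 mulf_eq0 invr_eq0 (negbTE n0)/=.
by move/eqP.
Qed.

HB.instance Definition _ :=
  Lmodule_isNormed.Build R dual_space normfD normfZ normf0_eq0.

End dual.


(* The completion of a vector space for a seminorm p: Cauchy sequences modulo
   null sequences. If p is a norm then completion_in is injective and this is
   the usual completion; for a general p it is the separated completion. *)
Record seminorm (R : realType) (V : lmodType R) := Seminorm {
  seminorm_fun :> V -> R ;
  seminormD : forall x y, seminorm_fun (x + y) <= seminorm_fun x + seminorm_fun y ;
  seminormZ : forall a x, seminorm_fun (a *: x) = `|a| * seminorm_fun x }.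

Section completion.
Context (R : realType) (V : lmodType R) (p : seminorm V).

Let p0 : p 0 = 0.
Proof. by rewrite -(scale0r 0) seminormZ normr0 mul0r. Qed.

Let pN x : p (- x) = p x.
Proof. by rewrite -scaleN1r seminormZ normrN1 mul1r. Qed.

Let pge0 x : 0 <= p x.
Proof. by have := seminormD p x (- x); rewrite pN subrr p0; lra. Qed.

Let pB x y : p (x - y) = p (y - x).
Proof. by rewrite -pN opprB. Qed.

Let pBle x y : `|p x - p y| <= p (x - y).
Proof.
rewrite ler_norml; have := seminormD p (x - y) y; have := seminormD p (y - x) x.
by rewrite !subrK (pB y) => *; apply/andP; split; lra.
Qed.

Definition cauchy_pred : {pred nat -> V} := mem [set u : nat -> V |
  forall e, 0 < e -> exists N, forall m n, (N <= m)%N -> (N <= n)%N ->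
    p (u m - u n) < e].

Record cauchy_seq := CauchySeq {
  cauchy_seq_fun :> nat -> V ; _ : cauchy_seq_fun \in cauchy_pred }.
HB.instance Definition _ := [isSub for cauchy_seq_fun].
HB.instance Definition _ := [Choice of cauchy_seq by <:].

Let cauchy_submod_closed : submod_closed cauchy_pred.
Proof.
split=> [|a u v].
  rewrite inE => e e0; exists 0%N => m n _ _.
  by rewrite (_ : (0 : nat -> V) m - _ = 0) ?p0 ?subrr.
rewrite !inE => cu cv e e0.
have a1 : 0 < 2 * (`|a| + 1) by have := normr_ge0 a; lra.
have [N HN] := cu _ (divr_gt0 e0 a1).
have [M HM] := cv _ (divr_gt0 e0 (ltr0n _ 2)).
exists (maxn N M) => m n; rewrite !geq_max => /andP[Nm Mm] /andP[Nn Mn].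
have -> : (a *: u + v) m - (a *: u + v) n = a *: (u m - u n) + (v m - v n).
  by rewrite scalerBr addrACA -opprD.
apply: (le_lt_trans (seminormD _ _ _)); rewrite seminormZ.
have {}HM := HM _ _ Mm Mn; have := HN _ _ Nm Nn.
rewrite ltr_pdivlMr// => {}HN.
have := pge0 (u m - u n); have := normr_ge0 a; nra.
Qed.
HB.instance Definition _ := GRing.isSubmodClosed.Build R (nat -> V) cauchy_pred
  cauchy_submod_closed.
HB.instance Definition _ := [SubChoice_isSubLmodule of cauchy_seq by <:].

Let cauchy_seqP (u : cauchy_seq) e : 0 < e -> exists N, forall m n,
  (N <= m)%N -> (N <= n)%N -> p (u m - u n) < e.
Proof. by have := valP u; rewrite inE; exact. Qed.

Definition null_seq : {pred cauchy_seq} :=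
  mem [set u : cauchy_seq | p \o u @ \oo --> 0].

Let null_submod_closed : submod_closed null_seq.
Proof.
split=> [|a u v].
  rewrite inE /=; rewrite (_ : p \o _ = cst 0); first exact: cvg_cst.
  by apply/funext => n /=; rewrite -[RHS]p0.
rewrite !inE /= => cu cv.
have cw : (fun n => `|a| * p (u n) + p (v n)) @ \oo --> 0.
  rewrite -[X in _ --> X](addr0 0) -{1}(mulr0 `|a|).
  by apply: cvgD => //; exact: cvgMr.
apply: squeeze_cvgr (cvg_cst 0) cw.
by near=> n => /=; rewrite pge0/= -seminormZ; exact: seminormD.
Unshelve. all: by end_near. Qed.
HB.instance Definition _ := GRing.isSubmodClosed.Build R cauchy_seq null_seq
  null_submod_closed.

Definition completion : Type := Quotient.quot null_seq.
HB.instance Definition _ := GRing.Zmodule.on completion.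
HB.instance Definition _ := EqQuotient.on completion.

Local Open Scope quotient_scope.

Definition completion_pi (u : cauchy_seq) : completion := \pi_completion u.

Let piP u v : completion_pi u = completion_pi v <-> p \o (u - v) @ \oo --> 0.
Proof.
split=> [/eqP|H]; last apply/eqP; rewrite -Quotient.idealrBE inE//.
Qed.

Let piD u v : completion_pi (u + v) = completion_pi u + completion_pi v.
Proof. exact: Quotient.pi_add. Qed.

Let piN u : completion_pi (- u) = - completion_pi u.
Proof. exact: Quotient.pi_opp. Qed.

Let pi_repr (x : completion) : completion_pi (repr x) = x.
Proof. exact: reprK. Qed.

Let scale a (x : completion) : completion := completion_pi (a *: repr x).

Let piZ a u : completion_pi (a *: u) = scale a (completion_pi u).
Proof.
apply/piP; rewrite -scalerBr.
have /esym/piP H := pi_repr (completion_pi u).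
rewrite (_ : p \o _ = (fun n => `|a| * (p \o (u - repr (completion_pi u))) n)).
  by rewrite -(mulr0 `|a|); exact: cvgMr.
by apply/funext => n /=; rewrite -seminormZ.
Qed.

Let scaleA a b x : scale a (scale b x) = scale (a * b) x.
Proof. by rewrite -[x]pi_repr -!piZ scalerA. Qed.

Let scale1 x : scale 1 x = x.
Proof. by rewrite /scale scale1r pi_repr. Qed.

Let scaleDr a x y : scale a (x + y) = scale a x + scale a y.
Proof.
by rewrite -[x]pi_repr -[y]pi_repr -piD -!piZ -piD scalerDr.
Qed.

Let scaleDl x a b : scale (a + b) x = scale a x + scale b x.
Proof. by rewrite -[x]pi_repr -!piZ -piD scalerDl. Qed.

HB.instance Definition _ := GRing.Zmodule_isLmodule.Build R completion
  scaleA scale1 scaleDr scaleDl.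

Let cvg_p (u : cauchy_seq) : cvgn (p \o u).
Proof.
apply/cauchy_cvgP/cauchy_exP => e e0.
have [N HN] := cauchy_seqP u e0.
exists (p (u N)); exists N => // n /= Nn.
rewrite -ball_normE /=; apply: le_lt_trans (pBle _ _) _.
exact: HN.
Qed.

Definition completion_norm (x : completion) : R := limn (p \o repr x).

Let cvg_norm (u : cauchy_seq) :
  p \o u @ \oo --> completion_norm (completion_pi u).
Proof.
set v := repr (completion_pi u).
have cv : p \o v @ \oo --> completion_norm (completion_pi u) by exact: cvg_p.
have /esym/piP : completion_pi v = completion_pi u by exact: pi_repr.
move=> d0.
suff H : (fun n => p (u n) - p (v n)) @ \oo --> 0.
  rewrite (_ : p \o u = (fun n => p (u n) - p (v n)) \+ (p \o v)).
    by rewrite -[X in _ --> X]add0r; exact: cvgD H cv.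
  by apply/funext => n /=; rewrite addrNK.
apply/norm_cvg0P; apply: squeeze_cvgr (cvg_cst 0) d0.
by apply: nearW => n /=; rewrite normr_ge0/= pBle.
Qed.

Let normE (u : cauchy_seq) (l : R) : p \o u @ \oo --> l -> completion_norm (completion_pi u) = l.
Proof. by move=> H; rewrite -(cvg_lim _ H)//; apply/esym/cvg_lim => //; exact: cvg_norm. Qed.

Let normD x y :
  completion_norm (x + y) <= completion_norm x + completion_norm y.
Proof.
rewrite -[x]pi_repr -[y]pi_repr -piD.
have H1 := @cvg_norm (repr x + repr y).
have H2 := cvgD (@cvg_norm (repr x)) (@cvg_norm (repr y)).
apply: (ler_cvg_to H1 (H2 _)).
by apply: nearW => n /=; exact: seminormD.
Qed.

Let normZ a x : completion_norm (a *: x) = `|a| * completion_norm x.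
Proof.
rewrite -[x in RHS]pi_repr; apply: normE.
rewrite (_ : p \o _ = (fun n => `|a| * (p \o repr x) n)).
  by apply: cvgMr; exact: cvg_norm.
by apply/funext => n /=; rewrite -seminormZ.
Qed.

Let norm0_eq0 x : completion_norm x = 0 -> x = 0.
Proof.
move=> x0; rewrite -[x]pi_repr.
have -> : (0 : completion) = completion_pi 0 by rewrite -[LHS](subrr (completion_pi 0)) -piN -piD subrr.
by apply/piP; rewrite subr0 -x0 -{2}[x]pi_repr; exact: cvg_norm.
Qed.

HB.instance Definition _ :=
  Lmodule_isNormed.Build R completion normD normZ norm0_eq0.

Let const_cauchy (v : V) : (fun _ : nat => v) \in cauchy_pred.
Proof. by rewrite inE => e e0; exists 0%N => *; rewrite subrr p0. Qed.

Definition completion_in (v : V) : completion :=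
  completion_pi (CauchySeq (const_cauchy v)).

Lemma completion_in_linear : linear completion_in.
Proof.
move=> a u v; rewrite /completion_in.
have -> : a *: completion_pi (CauchySeq (const_cauchy u)) =
          completion_pi (a *: CauchySeq (const_cauchy u)) by rewrite piZ.
by rewrite -piD; congr completion_pi; exact: val_inj.
Qed.
HB.instance Definition _ := GRing.isLinear.Build R V completion *:%R
  completion_in completion_in_linear.

Lemma completion_in_norm v : `|completion_in v| = p v.
Proof. by apply: (@normE (CauchySeq (const_cauchy v))); exact: (cvg_cst (p v)). Qed.

Let approx (u : cauchy_seq) e N :
  (forall m n, (N <= m)%N -> (N <= n)%N -> p (u m - u n) < e) ->
  forall n, (N <= n)%N -> `|completion_in (u n) - completion_pi u| <= e.
Proof.
move=> H n Nn; rewrite -piN -piD.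
have H1 := @cvg_norm (CauchySeq (const_cauchy (u n)) - u).
apply: (ler_cvg_to H1 (cvg_cst e)).
by exists N => // m /= Nm; exact/ltW/H.
Qed.

Lemma completion_in_dense x e : 0 < e -> exists v, `|x - completion_in v| < e.
Proof.
move=> e0; have [N HN] := cauchy_seqP (repr x) (divr_gt0 e0 (ltr0n _ 2)).
exists (repr x N); rewrite distrC -{2}[x]pi_repr.
by apply: le_lt_trans (approx HN (leqnn N)) _; lra.
Qed.

Let completion_complete (F : set_system completion) :
  ProperFilter F -> cauchy F -> cvg F.
Proof.
move=> FF /cauchyP Fc.
have i0 n : 0 < (n.+1%:R^-1 : R) by rewrite invr_gt0 ltr0n.
have /choice[x Fx] : forall n, exists x, F (ball x (n.+1%:R^-1)).
  by move=> n; exact: Fc.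
have /choice[v xv] : forall n, exists v, `|x n - completion_in v| < n.+1%:R^-1.
  by move=> n; exact: completion_in_dense.
have Hv m n : p (v m - v n) < 2 * m.+1%:R^-1 + 2 * n.+1%:R^-1.
  have [z [/=]] := filter_ex (filterI (Fx m) (Fx n)).
  rewrite -!ball_normE /= => zm zn.
  rewrite -completion_in_norm linearB/=.
  have := ler_distD (x m) (completion_in (v m)) (completion_in (v n)).
  have := ler_distD z (x m) (completion_in (v n)).
  have := ler_distD (x n) z (completion_in (v n)).
  have := xv m; have := xv n.
  rewrite (distrC z (x n)) (distrC (completion_in (v m)) (x m)).
  move: zm zn; move: (m.+1%:R^-1 : R) (n.+1%:R^-1 : R) => a b.
  lra.
have small e : 0 < e -> exists N, forall n, (N <= n)%N -> n.+1%:R^-1 < e :> R.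
  move=> e0; have [N _ HN] := near_infty_natSinv_lt (PosNum e0).
  by exists N.
have vc : v \in cauchy_pred.
  rewrite inE => e e0; have [N HN] := small _ (divr_gt0 e0 (ltr0n _ 4)).
  exists N => m n Nm Nn; apply: lt_le_trans (Hv _ _) _.
  have := HN _ Nm; have := HN _ Nn.
  by move: (m.+1%:R^-1 : R) (n.+1%:R^-1 : R) => a b; lra.
apply/cvg_ex; exists (completion_pi (CauchySeq vc)).
apply/cvgrPdist_lt => e e0.
have e8 : 0 < e / 8 by lra.
have [N HN] := small _ e8.
have H : `|completion_in (v N) - completion_pi (CauchySeq vc)| <= e / 2.
  apply: (@approx (CauchySeq vc) (e / 2) N) => // m n Nm Nn.
  apply: lt_le_trans (Hv _ _) _.
  have := HN _ Nm; have := HN _ Nn.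
  by move: (m.+1%:R^-1 : R) (n.+1%:R^-1 : R) => a b; lra.
apply: filterS (Fx N) => z; rewrite -ball_normE /= => xz.
have := ler_distD (x N) (completion_pi (CauchySeq vc)) z.
have := ler_distD (completion_in (v N)) (completion_pi (CauchySeq vc)) (x N).
have := xv N; have := HN N (leqnn N).
rewrite (distrC (completion_in (v N)) (x N)).
rewrite (distrC (completion_pi (CauchySeq vc)) (completion_in _)).
by move: (N.+1%:R^-1 : R) xz => a; lra.
Qed.

HB.instance Definition _ := Uniform_isComplete.Build completion
  completion_complete.

End completion.

(* X (x) Y is the span of the evaluations x (x) y : B |-> B x y in the space of
   functions on the bilinear forms on X * Y. Since the bilinear forms separate
   the points of the algebraic tensor product of two vector spaces, two finite
   sums of elementary tensors are equal here iff they are equal there. *)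
Section projective_tensor.
Context (R : realType) (X Y : normedModType R).

Definition bilin_form := {bilinear X -> Y -> R^o}.

Definition elem_tensor (x : X) (y : Y) : bilin_form -> R^o := fun B => B x y.

Definition tensor_pred : {pred bilin_form -> R^o} :=
  mem [set z | exists s : seq (X * Y), z = \sum_(i <- s) elem_tensor i.1 i.2].

Record tensor := Tensor {
  tensor_val :> bilin_form -> R^o ; _ : tensor_val \in tensor_pred }.
HB.instance Definition _ := [isSub for tensor_val].
HB.instance Definition _ := [Choice of tensor by <:].

Let sum_scale a (s : seq (X * Y)) :
  a *: \sum_(i <- s) elem_tensor i.1 i.2 =
  \sum_(i <- [seq (a *: i.1, i.2) | i <- s]) elem_tensor i.1 i.2.
Proof.
rewrite big_map scaler_sumr; apply: eq_bigr => i _.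
by apply/funext => B; rewrite /elem_tensor linearZl_LR.
Qed.

Let tensor_submod_closed : submod_closed tensor_pred.
Proof.
split=> [|a z w]; first by rewrite inE; exists [::]; rewrite big_nil.
rewrite !inE => -[s ->] [t ->].
exists ([seq (a *: i.1, i.2) | i <- s] ++ t).
by rewrite big_cat -sum_scale.
Qed.
HB.instance Definition _ := GRing.isSubmodClosed.Build R (bilin_form -> R^o)
  tensor_pred tensor_submod_closed.
HB.instance Definition _ := [SubChoice_isSubLmodule of tensor by <:].

Definition proj_costs (z : tensor) : set R :=
  [set \sum_(i <- s) `|i.1| * `|i.2| |
    s in [set s : seq (X * Y) | val z = \sum_(i <- s) elem_tensor i.1 i.2]].

(* No scalars occur in the representations: a *: (x (x) y) = (a *: x) (x) y. *)
Definition proj_norm (z : tensor) : R := inf (proj_costs z).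

Let cost_ge0 (s : seq (X * Y)) : 0 <= \sum_(i <- s) `|i.1| * `|i.2|.
Proof. by apply: sumr_ge0 => i _; rewrite mulr_ge0. Qed.

Let has_inf_costs z : has_inf (proj_costs z).
Proof.
split; last by exists 0 => _ [s _ <-].
have := valP z; rewrite inE => -[s zs].
by exists (\sum_(i <- s) `|i.1| * `|i.2|), s.
Qed.

Let proj_norm_ge0 z : 0 <= proj_norm z.
Proof.
by apply: lb_le_inf; [case: (has_inf_costs z)|move=> _ [s _ <-]].
Qed.

Let proj_norm_le z s : val z = \sum_(i <- s) elem_tensor i.1 i.2 ->
  proj_norm z <= \sum_(i <- s) `|i.1| * `|i.2|.
Proof. by move=> zs; apply: ge_inf; [case: (has_inf_costs z)|exists s]. Qed.

Let proj_normD z w : proj_norm (z + w) <= proj_norm z + proj_norm w.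
Proof.
apply/ler_addgt0Pr => e e0.
have e2 : 0 < e / 2 by lra.
have [_ [s zs <-] hs] := inf_adherent e2 (has_inf_costs z).
have [_ [t wt <-] ht] := inf_adherent e2 (has_inf_costs w).
have /proj_norm_le : val (z + w) = \sum_(i <- s ++ t) elem_tensor i.1 i.2.
  by rewrite big_cat /= -zs -wt.
rewrite big_cat /=; move: hs ht; rewrite -/(proj_norm z) -/(proj_norm w).
lra.
Qed.

Let proj_normZle a z : proj_norm (a *: z) <= `|a| * proj_norm z.
Proof.
have [->|a0] := eqVneq a 0.
  rewrite normr0 mul0r scale0r.
  by apply: le_trans (@proj_norm_le _ [::] _) _; rewrite !big_nil.
rewrite -ler_pdivrMl ?normr_gt0//.
apply: lb_le_inf; first by case: (has_inf_costs z).
move=> _ [s zs <-]; rewrite ler_pdivrMl ?normr_gt0//.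
have /proj_norm_le : val (a *: z) =
    \sum_(i <- [seq (a *: i.1, i.2) | i <- s]) elem_tensor i.1 i.2.
  by rewrite -sum_scale -zs.
rewrite big_map /= => /le_trans; apply.
by rewrite mulr_sumr; apply: ler_sum => i _; rewrite normrZ mulrA.
Qed.

Let proj_normZ a z : proj_norm (a *: z) = `|a| * proj_norm z.
Proof.
apply/eqP; rewrite eq_le proj_normZle/=.
have [->|a0] := eqVneq a 0; first by rewrite normr0 mul0r proj_norm_ge0.
rewrite -ler_pdivlMl ?normr_gt0// -normfV.
by rewrite -{1}[z]scale1r -(mulVf a0) -scalerA proj_normZle.
Qed.

(* The projective norm is a norm, but separation is not needed to complete. *)
Definition proj_seminorm : seminorm tensor := Seminorm proj_normD proj_normZ.

Definition proj_tensor : completeNormedModType R := completion proj_seminorm.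

End projective_tensor.

Section superreflexive.
Context (R : realType).

Definition findim_subspace (V : lmodType R) (E : set V) :=
  exists (n : nat) (b : 'I_n -> V),
    E = [set \sum_(i < n) a i *: b i | a in [set: 'I_n -> R]].

Definition finite_dimensional (V : lmodType R) := findim_subspace [set: V].

Definition linear_on (V W : lmodType R) (E : set V) (T : V -> W) :=
  forall (a : R) x y, E x -> E y -> T (a *: x + y) = a *: T x + T y.

(* T is only relevant on E and S on F, where S is the inverse of T : E -> F. *)
Definition finitely_representable (W V : normedModType R) :=
  forall (E : set W) (e : R), findim_subspace E -> 0 < e ->
  exists (F : set V) (T : W -> V) (S : V -> W),
    [/\ findim_subspace F, linear_on E T, set_bij E F T,
        {in E, cancel T S} & opnorm E T * opnorm F S <= 1 + e].

(* The canonical embedding of V into its bidual is onto. *)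
Definition is_reflexive (V : normedModType R) :=
  forall Phi : dual_space (dual_space V),
    exists x : V, forall f : dual_space V, Phi f = f x.

Definition superreflexive (V : completeNormedModType R) :=
  forall W : completeNormedModType R,
    finitely_representable W V -> is_reflexive W.

End superreflexive.

(* Main.v *)
From HB Require Import structures.
Require Import Defs.
From mathcomp Require Import all_boot all_order all_algebra.
From mathcomp Require Import all_classical all_reals all_analysis.
From mathcomp Require Import perm ring lra.

Set Implicit Arguments.
Unset Strict Implicit.
Unset Printing Implicit Defensive.

Import Order.TTheory GRing.Theory Num.Theory.
Import numFieldNormedType.Exports.

Local Open Scope classical_set_scope.
Local Open Scope ring_scope.


(** If X is finite-dimensional with basis b_1, ..., b_n, the coordinate maps
    embed X (x) Y isomorphically into Y^n, and superreflexivity passes to such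
    subspaces.  Indeed let W be finitely representable in V and let V embed in
    Y^n through bounded maps q_k.  The almost isometries T : E -> V, for E
    finite-dimensional in W, form a filter; along an ultrafilter refining it,
    lim |sum_k q_k (T w_k)| is a seminorm on W^n.  Its completion W0 is finitely
    representable in Y ([completion_finitely_representable]), hence reflexive,
    and W embeds in W0^n; a Hahn-Banach argument then makes W reflexive
    ([reflexive_of_embedding]).

    Conversely, if X and Y are both infinite-dimensional, X (x) Y contains
    uniformly isomorphic copies of all the spaces l1^N, which no superreflexive
    space does.  The diagonal of l2 (x) l2 is a copy of l1: it is tested by the
    bilinear forms sum_k c_k x_k y_k with |c_k| <= 1, all of norm at most 1.  To
    imitate this in X (x) Y one wants, for every N, a positive semidefinite form
    q with q x x <= |x|^2 on X and N vectors of the unit ball of X that are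
    almost orthogonal for q and not small for q; this is a form of the
    Dvoretzky-Rogers lemma ([dvoretzky_rogers]).  It is obtained by taking q so
    that its Gram determinant on n independent vectors is nearly maximal, with n
    much larger than N: if no further vector could be added to an almost
    orthogonal family, then penalizing q in the directions of the family and
    rescaling would give an admissible form with a much larger determinant, the
    penalty costing a factor that depends on N only while the rescaling gains a
    factor exponential in n.  Given such systems in X and in Y, the tensors
    x_i (x) y_i span l1^N with constant 16 ([proj_tensor_contains_l1]).  The
    limit of these copies along an ultrafilter is a norm on finitely supported
    sequences, equivalent to that of l1; its completion is finitely
    representable in X (x) Y and the limit of f at the unit vectors is a bidual
    element which no point represents ([not_superreflexive_of_l1]). *)

(** * Determinants under rank-one perturbations *)

(** Read off from two block-triangular factorizations of the bordered matrix
    with diagonal blocks 1, 1 and off-diagonal blocks u, v. *)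
Lemma det_1subM (R : comPzRingType) n (u : 'cV[R]_n) (v : 'rV[R]_n) :
  \det (1%:M - u *m v) = 1 - (v *m u) 0 0.
Proof.
have E : block_mx (1%:M - u *m v) u 0 1%:M *m block_mx 1%:M 0 v 1%:M =
         block_mx 1%:M 0 v 1%:M *m block_mx 1%:M u 0 (1%:M - v *m u).
  rewrite !mulmx_block !mulmx1 !mul1mx !mulmx0 !mul0mx !addr0 !add0r.
  by rewrite !subrK addrC subrK.
have := congr1 determinant E.
rewrite !det_mulmx !det_ublock !det_lblock !det1 !mulr1 !mul1r => ->.
by rewrite det_mx11 !mxE.
Qed.

Lemma det_sub_rank1 (R : fieldType) n (M : 'M[R]_n) (w : 'rV[R]_n) s :
  M \in unitmx ->
  \det (M - s *: (w^T *m w)) = \det M * (1 - s * (w *m invmx M *m w^T) 0 0).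
Proof.
move=> uM.
have -> : M - s *: (w^T *m w) = M *m (1%:M - (s *: (invmx M *m w^T)) *m w).
  by rewrite mulmxBr mulmx1 -scalemxAl -scalemxAr !mulmxA mulmxV// mul1mx.
by rewrite det_mulmx det_1subM -scalemxAr mulmxA !mxE.
Qed.

(** At z = w M^-1 the last hypothesis reads s w M^-1 w^T <= c, which is what
    [det_sub_rank1] needs.  It is phrased with quadratic forms because that is
    how inequalities between semi-inner products reach the determinant. *)
Lemma det_sub_rank1_ge (R : realFieldType) n (M : 'M[R]_n) (w : 'rV[R]_n) s c :
  M^T = M -> 0 < \det M -> 0 <= s -> 0 <= c ->
  (forall z : 'rV[R]_n, 0 <= (z *m M *m z^T) 0 0) ->
  (forall z : 'rV[R]_n, s * (w *m z^T) 0 0 ^+ 2 <= c * (z *m M *m z^T) 0 0) ->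
  (1 - c) * \det M <= \det (M - s *: (w^T *m w)).
Proof.
move=> Msym M0 s0 c0 Mpos H.
have uM : M \in unitmx by rewrite unitmxE unitfE gt_eqF.
rewrite det_sub_rank1// mulrC; apply: ler_wpM2l; first exact: ltW.
rewrite lerD2l lerN2.
have := H (w *m invmx M); have := Mpos (w *m invmx M).
rewrite -mulmxA trmx_mul trmx_inv Msym mulmxA [w *m invmx M *m M]mulmxKV//.
rewrite mulmxA; set a := (w *m _ *m _) 0 0; move=> a0.
have [->|an0] := eqVneq a 0; first by move=> _; rewrite mulr0.
by rewrite expr2 mulrA ler_pM2r// lt_def an0.
Qed.

Lemma normr_det_le (R : realFieldType) n (M : 'M[R]_n) (B : R) :
  (forall i j, `|M i j| <= B) -> `|\det M| <= #|{: {perm 'I_n}}|%:R * B ^+ n.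
Proof.
move=> H; rewrite /determinant (le_trans (ler_norm_sum _ _ _))//.
rewrite (le_trans (ler_sum _ (G := fun=> B ^+ n) _))//; last first.
  by rewrite sumr_const mulr_natl.
move=> s _; rewrite normrMsign normr_prod.
apply: (@le_trans _ _ (\prod_(i < n) B)); last by rewrite prodr_const card_ord.
by apply: ler_prod => i _; rewrite normr_ge0 H.
Qed.

(** * Semi-inner products and their Gram determinants *)

Definition semi_inner (R : realType) (X : lmodType R) (q : X -> X -> R) :=
  [/\ forall x y, q x y = q y x,
      forall a x y z, q x (a *: y + z) = a * q x y + q x z &
      forall x, 0 <= q x x].

Definition gram (R : realType) (X : lmodType R) (q : X -> X -> R) n
  (b : 'I_n -> X) : 'M[R]_n := \matrix_(i, j) q (b i) (b j).

Section SemiInner.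
Context (R : realType) (X : lmodType R) (q : X -> X -> R).
Hypothesis qS : semi_inner q.

Lemma semi_inner_linear x : linear (q x : X -> R^o).
Proof. by case: qS => _ qD _ a y z; rewrite qD. Qed.

Definition semi_inner_lin x : {linear X -> R^o} :=
  HB.pack (q x : X -> R^o)
    (GRing.isLinear.Build R X R^o *:%R _ (semi_inner_linear x)).

Lemma semi_innerC x y : q x y = q y x.
Proof. by case: qS. Qed.

Lemma semi_innerZ a x y : q x (a *: y) = a * q x y.
Proof. exact: (linearZ_LR (semi_inner_lin x)). Qed.

Lemma semi_inner_sum (I : Type) (r : seq I) (a : I -> R) (v : I -> X) x :
  q x (\sum_(i <- r) a i *: v i) = \sum_(i <- r) a i * q x (v i).
Proof.
apply: etrans (linear_sum (semi_inner_lin x) _ _ _) _; apply: eq_bigr => i _.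
exact: semi_innerZ.
Qed.

Lemma semi_inner_diagZ a x : q (a *: x) (a *: x) = a ^+ 2 * q x x.
Proof. by rewrite semi_innerZ semi_innerC semi_innerZ mulrA expr2. Qed.

Lemma semi_inner_CS x y : q x y ^+ 2 <= q x x * q y y.
Proof.
have qp : forall u, 0 <= q u u by case: qS.
have key t : 0 <= q x x + 2 * t * q x y + t ^+ 2 * q y y.
  have := qp (t *: y + x).
  case: qS => _ qD _; rewrite !qD [q _ y]semi_innerC [q _ x]semi_innerC !qD.
  by rewrite [q y x]semi_innerC; lra.
have [y0|y0] := eqVneq (q y y) 0.
  have [->|xy0] := eqVneq (q x y) 0; first by rewrite y0 mulr0 expr0n.
  have := key (- (q x x + 1) / (2 * q x y)).
  rewrite y0 mulr0 addr0 (_ : 2 * _ * _ = - (q x x + 1)); first by have := qp x; lra.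
  by field.
have yp : 0 < q y y by rewrite lt_def y0 qp.
have := key (- q x y / q y y).
rewrite (_ : _ + _ + _ = (q x x * q y y - q x y ^+ 2) / q y y); last by field.
by rewrite pmulr_lge0 ?invr_gt0// subr_ge0.
Qed.

Lemma gram_quad n (b : 'I_n -> X) (z : 'rV[R]_n) :
  (z *m gram q b *m z^T) 0 0 =
  q (\sum_i z 0 i *: b i) (\sum_i z 0 i *: b i).
Proof.
rewrite mxE semi_inner_sum; apply: eq_bigr => j _; rewrite !mxE mulrC; congr (_ * _).
rewrite semi_innerC semi_inner_sum; apply: eq_bigr => i _; rewrite !mxE.
by rewrite semi_innerC.
Qed.

Lemma gram_sym n (b : 'I_n -> X) : (gram q b)^T = gram q b.
Proof. by apply/matrixP => i j; rewrite !mxE semi_innerC. Qed.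

End SemiInner.

Section Penalty.
Context (R : realType) (X : lmodType R) (q : X -> X -> R) (s : R).
Hypothesis qS : semi_inner q.
Hypothesis s0 : 0 <= s.

(** Subtracting these rank-one forms makes q small in the directions that xs
    already represents. *)
Definition penalized (xs : seq X) (x y : X) :=
  q x y - s * \sum_(v <- xs) q x v * q y v.

Lemma penalized_cons v xs x y :
  penalized (v :: xs) x y = penalized xs x y - s * (q x v * q y v).
Proof. by rewrite /penalized big_cons mulrDr; ring. Qed.

(** By the Cauchy-Schwarz inequality every penalty term takes away at most
    s q x x. *)
Lemma penalized_ge xs x : (forall v, v \in xs -> q v v <= 1) ->
  2 * s * (size xs)%:R <= 1 -> q x x <= 2 * penalized xs x x.
Proof.
have [_ _ qp] := qS.
move=> xs1 sxs; suff : s * \sum_(v <- xs) q x v * q x v <= 1 / 2 * q x x.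
  by rewrite /penalized; lra.
have H : \sum_(v <- xs) q x v * q x v <= (size xs)%:R * q x x.
  elim: xs xs1 {sxs} => [|v xs IH] xs1; first by rewrite big_nil mul0r.
  rewrite big_cons /= -natr1 mulrDl mul1r addrC lerD//.
    by apply: IH => u uxs; apply: xs1; rewrite inE uxs orbT.
  have := semi_inner_CS qS x v; have := xs1 v (mem_head _ _); have := qp x.
  have := qp v; rewrite expr2; nra.
apply: le_trans (ler_wpM2l s0 H) _; rewrite mulrA; apply: ler_wpM2r => //.
lra.
Qed.

Lemma penalized_semi_inner xs : (forall v, v \in xs -> q v v <= 1) ->
  2 * s * (size xs)%:R <= 1 -> semi_inner (penalized xs).
Proof.
move=> xs1 sxs; split.
- move=> x y; rewrite /penalized (semi_innerC qS x y); congr (_ - s * _).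
  by apply: eq_bigr => v _; rewrite mulrC.
- move=> a x y z; elim: xs {xs1 sxs} => [|v xs IH].
    by rewrite /penalized !big_nil; case: qS => _ -> _; ring.
  rewrite !penalized_cons IH [q (_ + z) v](semi_innerC qS).
  case: qS => _ -> _; rewrite (semi_innerC qS v y) (semi_innerC qS v z).
  ring.
- move=> x; have := penalized_ge x xs1 sxs; have [_ _ /(_ x)] := qS; lra.
Qed.

(** Each penalty is a rank-one perturbation of the Gram matrix and costs a
    factor 1 - 2 s, whatever the number n of vectors: this is what allows n to
    be chosen after s and the length of xs. *)
Lemma det_penalized n (b : 'I_n -> X) xs : (forall v, v \in xs -> q v v <= 1) ->
  2 * s * (size xs)%:R <= 1 -> 2 * s < 1 -> 0 < \det (gram q b) ->
  (1 - 2 * s) ^+ size xs * \det (gram q b) <= \det (gram (penalized xs) b).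
Proof.
move=> + + s1 q0; elim: xs => [|v xs IH] xs1 sxs.
  rewrite expr0 mul1r le_eqVlt; apply/orP; left; apply/eqP; congr (\det _).
  by apply/matrixP => i j; rewrite !mxE /penalized big_nil; ring.
have xs1' u : u \in xs -> q u u <= 1.
  by move=> uxs; apply: xs1; rewrite inE uxs orbT.
have sxs' : 2 * s * (size xs)%:R <= 1.
  by move: sxs; rewrite /= -[(size xs).+1%:R]natr1 mulrDr; have := s0; lra.
have {}IH := IH xs1' sxs'.
have pS := penalized_semi_inner xs1' sxs'.
have [_ _ pp] := pS.
pose w : 'rV[R]_n := \row_i q (b i) v.
have -> : gram (penalized (v :: xs)) b = gram (penalized xs) b - s *: (w^T *m w).
  apply/matrixP => i j; rewrite !mxE big_ord1 !mxE penalized_cons.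
  by ring.
rewrite exprS -mulrA; apply: le_trans (ler_wpM2l _ IH) _; first by lra.
apply: det_sub_rank1_ge => //; last 2 first.
- by move=> z; rewrite gram_quad.
- move=> z; rewrite gram_quad//; set u := \sum_i _.
  have -> : (w *m z^T) 0 0 = q v u.
    rewrite mxE semi_inner_sum//; apply: eq_bigr => i _.
    by rewrite !mxE mulrC (semi_innerC qS).
  have := penalized_ge u xs1' sxs'; have := semi_inner_CS qS v u.
  have := xs1 v (mem_head _ _); have [_ _ qp] := qS; have := qp v; have := qp u.
  set A := penalized xs u u; move: (q u u) (q v v) (q v u ^+ 2) => B C D.
  move=> B0 C0 C1 DCB B2A; have DA : D <= 2 * A by nra.
  by have := ler_wpM2l s0 DA; rewrite mulrA [s * 2]mulrC.
- exact: gram_sym.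
- apply: lt_le_trans IH; apply: mulr_gt0 => //; apply: exprn_gt0; lra.
- by have := s0; lra.
Qed.

End Penalty.

(** * A Dvoretzky-Rogers lemma *)

(** Equivalently, the canonical map of X to the Hilbert space of q has norm at
    most 1. *)
Definition contractive (R : realType) (X : normedModType R) (q : X -> X -> R) :=
  semi_inner q /\ forall x, q x x <= `|x| ^+ 2.

Section DvoretzkyRogers.
Context (R : realType) (X : normedModType R).
Implicit Types (q : X -> X -> R) (x : X).

Lemma contractive_norm q x y : contractive q -> `|q x y| <= `|x| * `|y|.
Proof.
move=> [qS qx]; rewrite -(@ler_pXn2r _ 2)// ?nnegrE ?mulr_ge0//.
rewrite real_normK ?num_real// exprMn; apply: le_trans (semi_inner_CS qS x y) _.
by have [_ _ qp] := qS; apply: ler_pM.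
Qed.

(** The determinants are bounded because the entries of the Gram matrix are.
    Near maximality up to a factor 2 replaces an exact maximizer, whose
    existence would ask for a compactness argument on forms. *)
Lemma near_max_det n (b : 'I_n -> X) :
  (exists2 q, contractive q & 0 < \det (gram q b)) ->
  exists q, [/\ contractive q, 0 < \det (gram q b) &
    forall q', contractive q' -> \det (gram q' b) < 2 * \det (gram q b)].
Proof.
move=> [q0 q0c q0d].
pose A := [set \det (gram q b) | q in contractive (X := X)].
have supA : has_sup A.
  split; first by exists (\det (gram q0 b)), q0.
  pose S := \sum_i `|b i|.
  have bS i : `|b i| <= S.
    by rewrite /S (bigD1 i)//= lerDl; apply: sumr_ge0.
  exists (#|{: {perm 'I_n}}|%:R * (S * S) ^+ n) => _ [q qc <-].
  apply: le_trans (ler_norm _) _; apply: normr_det_le => i j; rewrite mxE.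
  by apply: le_trans (contractive_norm _ _ qc) _; apply: ler_pM.
have A0 : 0 < sup A.
  by apply: lt_le_trans q0d _; apply: ub_le_sup; [case: supA|exists q0].
have A2 : 0 < sup A / 2 by lra.
have [_ [q qc <-] hq] := sup_adherent A2 supA.
exists q; split => //; first lra.
move=> q' q'c; apply: (@le_lt_trans _ _ (sup A)); last lra.
by apply: ub_le_sup; [case: supA|exists q'].
Qed.

(** Suppose that q x x - C sum_v (q x v)^2 < 1/2 on the unit ball.  With
    t = s / C, the form penalized by s is the combination
    (1 - t) q + t (q - C sum_v (q . v)^2), so it is bounded by
    (1 - t / 2) |x|^2; dividing by 1 - t / 2 keeps it contractive and multiplies
    the determinant by (1 - t / 2)^-n, against a loss of (1 - 2 s)^(size xs)
    caused by the penalty.  This contradicts the near maximality of q. *)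
Lemma near_max_direction n (b : 'I_n -> X) q s C (xs : seq X) :
  contractive q -> 0 < \det (gram q b) ->
  (forall q', contractive q' -> \det (gram q' b) < 2 * \det (gram q b)) ->
  0 < s -> s <= C -> 2 * s < 1 -> 2 * s * (size xs)%:R <= 1 ->
  2 <= (1 - s / C / 2) ^- n * (1 - 2 * s) ^+ size xs ->
  (forall v, v \in xs -> `|v| <= 1) ->
  exists2 x, `|x| <= 1 & 1 / 2 <= q x x - C * \sum_(v <- xs) q x v * q x v.
Proof.
move=> [qS qc] qd qmax s0 sC s1 sxs hn xs1.
have C0 : 0 < C by lra.
have qxs v : v \in xs -> q v v <= 1.
  by move=> vxs; rewrite (le_trans (qc v))// expr_le1// xs1.
apply: contrapT => H.
(* the assumed failure on the unit ball, in homogeneous form *)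
have {}H x : q x x - C * \sum_(v <- xs) q x v * q x v <= `|x| ^+ 2 / 2.
  have [x0|x0] := eqVneq `|x| 0.
    have := qc x; rewrite x0 expr0n/= mul0r; apply: le_trans.
    rewrite gerBl mulr_ge0 ?(ltW C0)// sumr_ge0// => v _.
    by rewrite -expr2 sqr_ge0.
  have xp : 0 < `|x| by rewrite lt_def x0/=.
  pose u := `|x|^-1 *: x.
  have xu : x = `|x| *: u by rewrite scalerA divff// scale1r.
  have u1 : `|u| <= 1 by rewrite normrZ normfV normr_id mulVf.
  have {H} : q u u - C * \sum_(v <- xs) q u v * q u v < 1 / 2.
    by rewrite ltNge; apply/negP => h; apply: H; exists u.
  have -> : q x x = `|x| ^+ 2 * q u u by rewrite {1 2}xu semi_inner_diagZ.
  have -> : \sum_(v <- xs) q x v * q x v =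
      `|x| ^+ 2 * \sum_(v <- xs) q u v * q u v.
    rewrite mulr_sumr; apply: eq_bigr => v _.
    rewrite {1 2}xu !(semi_innerC qS _ v) semi_innerZ//; ring.
  move: (q u u) (\sum_(v <- xs) _) => A B AB.
  have := ler_wpM2l (sqr_ge0 `|x|) (ltW AB); lra.
set lam := (1 - s / C / 2)^-1.
have sC1 : s / C <= 1 by rewrite ler_pdivrMr// mul1r.
have sC0 : 0 < s / C by rewrite divr_gt0.
have lam0 : 0 < lam by rewrite invr_gt0; lra.
have pS := penalized_semi_inner qS (ltW s0) qxs sxs.
pose q' x y := lam * penalized q s xs x y.
have q'c : contractive q'.
  split; first split.
  - by move=> x y; rewrite /q' (semi_innerC pS).
  - by move=> a x y z; rewrite /q'; case: pS => _ -> _; ring.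
  - by move=> x; rewrite mulr_ge0 ?(ltW lam0)//; case: pS.
  move=> x; rewrite /q' /lam mulrC ler_pdivrMr; last lra.
  rewrite /penalized -{1}[s](divfK (lt0r_neq0 C0)) -[s / C * C * _]mulrA.
  have := H x; have := qc x; move: (C * _) (`|x| ^+ 2) (q x x) => B N A.
  move: sC1 sC0; move: (s / C) => t t1 t0 AN ABN;
  have h1 : 0 <= (1 - t) * (N - A) by apply: mulr_ge0; lra.
  have h2 : 0 <= t * (N / 2 - (A - B)) by apply: mulr_ge0; lra.
  lra.
have := qmax _ q'c; apply/negP; rewrite -leNgt.
have -> : gram q' b = lam *: gram (penalized q s xs) b.
  by apply/matrixP => i j; rewrite !mxE.
have detp := det_penalized qS (ltW s0) qxs sxs s1 qd.
rewrite detZ; apply: le_trans (ler_wpM2l _ detp); last first.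
  by rewrite exprn_ge0// ltW.
by rewrite mulrA ler_wpM2r ?(ltW qd)// /lam exprVn.
Qed.

(** Bernoulli's inequality. *)
Lemma exists_powV_ge (t c : R) : 0 < t -> t < 1 -> 0 < c ->
  exists n : nat, 2 <= (1 - t) ^- n * c.
Proof.
move=> t0 t1 c0; pose n := Num.truncn (2 / c / t); exists n.+1.
rewrite -ler_pdivrMr//.
have n2 : 2 / c / t < n.+1%:R by exact: Num.Theory.truncnS_gt.
have B m : 1 + m%:R * t <= (1 - t) ^- m.
  elim: m => [|m IH]; first by rewrite mul0r addr0 expr0 invr1.
  have t1' : 0 < 1 - t by lra.
  rewrite exprS invfM -[X in X <= _]mul1r -[X in X * _](mulVf (lt0r_neq0 t1')) -mulrA.
  rewrite ler_wpM2l ?invr_ge0 ?(ltW t1')//; apply: le_trans IH.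
  rewrite -natr1; have m0 : 0 <= m%:R :> R by []; nra.
apply: le_trans (B n.+1); move: n2; rewrite ltr_pdivrMr//; lra.
Qed.

(** The vectors are chosen one after the other by [near_max_direction], all for
    the same nearly maximizing form: with C larger than eps^-2, the inequality
    q x x - C sum_j (q x x_j)^2 >= 1/2 forces both q x x >= 1/2 and
    |q x x_j| <= eps.  The hypothesis on Gram determinants is how the infinite
    dimension of X enters. *)
Lemma dvoretzky_rogers (N : nat) (eps : R) : 0 < eps ->
  (forall n, exists b : 'I_n -> X,
    exists2 q, contractive q & 0 < \det (gram q b)) ->
  exists (q : X -> X -> R) (x : nat -> X), contractive q /\
    forall i, (i < N)%N -> [/\ `|x i| <= 1, 1 / 2 <= q (x i) (x i) &
      forall j, (j < i)%N -> `|q (x i) (x j)| <= eps].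
Proof.
move=> e0 inf.
pose C := 1 + eps ^- 2; pose s : R := (4 * N.+1%:R)^-1.
have e2 : 0 < eps ^- 2 by rewrite invr_gt0 exprn_gt0.
have N1 : 1 <= N.+1%:R :> R by rewrite ler1n.
have s0 : 0 < s by rewrite invr_gt0; lra.
have sN : s * (4 * N.+1%:R) = 1 by rewrite mulVf//; lra.
have s1 : 4 * s <= 1 by nra.
have C1 : 1 < C by rewrite /C; lra.
have C0 : 0 < C by lra.
have [n hn] : exists n, 2 <= (1 - s / C / 2) ^- n * (1 - 2 * s) ^+ N.
  apply: exists_powV_ge; last by rewrite exprn_gt0//; lra.
    by rewrite !divr_gt0.
  rewrite ltr_pdivrMr// ltr_pdivrMr//; lra.
have [b /near_max_det[q [qc qd qmax]]] := inf n.
exists q.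
suff [x Hx] : exists x : nat -> X, forall i, (i < N)%N ->
    [/\ `|x i| <= 1, 1 / 2 <= q (x i) (x i) &
      forall j, (j < i)%N -> `|q (x i) (x j)| <= eps] by exists x.
suff : forall m, (m <= N)%N -> exists x : nat -> X, forall i, (i < m)%N ->
    [/\ `|x i| <= 1, 1 / 2 <= q (x i) (x i) &
      forall j, (j < i)%N -> `|q (x i) (x j)| <= eps] by apply.
elim=> [|m IH] mN; first by exists (fun=> 0).
have [x Hx] := IH (ltnW mN).
pose xs := [seq x i | i <- iota 0 m].
have sz : size xs = m by rewrite size_map size_iota.
have [|||||v v1 vq] := @near_max_direction n b q s C xs qc qd qmax s0.
- lra.
- lra.
- have mN' : m%:R <= N.+1%:R :> R by rewrite ler_nat (leq_trans (ltnW mN)).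
  rewrite sz; nra.
- apply: le_trans hn _; apply: ler_wpM2l.
    rewrite invr_ge0 exprn_ge0// subr_ge0 ler_pdivrMr// ler_pdivrMr//; lra.
  by rewrite sz ler_wiXn2l//; [lra|lra|exact: ltnW].
- move=> v /mapP[i]; rewrite mem_iota add0n => /andP[_ im] ->.
  by case: (Hx i im).
exists (fun i => if i == m then v else x i) => i; rewrite ltnS leq_eqVlt.
case/orP => [/eqP ->|im].
  rewrite eqxx; split => //.
    apply: le_trans vq _; rewrite gerBl mulr_ge0 ?(ltW C0)// sumr_ge0// => u _.
    by rewrite -expr2 sqr_ge0.
  move=> j jm; rewrite ltn_eqF//.
  have S1 : q v (x j) * q v (x j) <= \sum_(u <- xs) q v u * q v u.
    rewrite big_map (bigD1_seq j) ?iota_uniq ?mem_iota//= lerDl sumr_ge0// => u _.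
    by rewrite -expr2 sqr_ge0.
  rewrite -(@ler_pXn2r _ 2)// ?nnegrE ?(ltW e0)// real_normK ?num_real//.
  have [qS qn] := qc; have qv1 : q v v <= 1 by rewrite (le_trans (qn v))// expr_le1.
  have : C * (q v (x j) * q v (x j)) <= 1.
    by have := ler_wpM2l (ltW C0) S1; lra.
  rewrite -expr2 /C; have := sqr_ge0 (q v (x j)).
  move: (q v (x j) ^+ 2) => A A0; rewrite mulrDl mul1r => h.
  have : eps ^- 2 * A <= 1 by lra.
  by rewrite mulrC ler_pdivrMr ?exprn_gt0// mul1r.
rewrite ltn_eqF//; have [x1 xq xj] := Hx i im; split => // j ji.
by rewrite ltn_eqF ?(ltn_trans ji)//; exact: xj.
Qed.

End DvoretzkyRogers.

(** * The Hahn-Banach theorem *)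

Section HahnBanach.
Context (R : realType) (V : lmodType R) (p : seminorm V).

Lemma seminorm0 : p 0 = 0.
Proof. by rewrite -(scale0r 0) seminormZ normr0 mul0r. Qed.

Lemma seminorm_ge0 x : 0 <= p x.
Proof.
have := seminormD p x (- x).
by rewrite -scaleN1r seminormZ normrN1 mul1r scaleN1r subrr seminorm0; lra.
Qed.

(** Partial linear functionals below p are encoded by their graphs, so that the
    order of extension is inclusion and chains have their union as a bound. *)
Definition dominated_graph (G : set (V * R)) :=
  [/\ forall x a b, G (x, a) -> G (x, b) -> a = b,
      forall c x a y b, G (x, a) -> G (y, b) -> G (c *: x + y, c * a + b) &
      forall x a, G (x, a) -> a <= p x].

(** The value r at y has to satisfy a - p (u - y) <= r <= p (x + y) - b for all
    (u, a) and (x, b) in the graph; subadditivity makes every left-hand side at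
    most every right-hand side, and r is the supremum of the former. *)
Lemma dominated_graph_extend G y : dominated_graph G -> G (0, 0) ->
  (forall a, ~ G (y, a)) ->
  exists G', [/\ dominated_graph G', G `<=` G' & exists a, G' (y, a)].
Proof.
move=> [Gf Gl Gp] G0 Gy.
have GZ c x a : G (x, a) -> G (c *: x, c * a).
  by move=> Gx; have := Gl c x a 0 0 Gx G0; rewrite !addr0.
have lr u a x b : G (u, a) -> G (x, b) -> a - p (u - y) <= p (x + y) - b.
  move=> Gu Gx; have := Gl 1 u a x b Gu Gx; rewrite scale1r mul1r => /Gp.
  have := seminormD p (u - y) (x + y).
  by rewrite addrACA [- y + y]addrC subrr addr0; lra.
pose S := [set t | exists2 ua : V * R, G ua & t = ua.2 - p (ua.1 - y)].
have S0 : has_sup S.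
  split; first by exists (0 - p (0 - y)), (0, 0).
  by exists (p (0 + y) - 0) => _ [[u a] Gu ->]; exact: lr.
pose r := sup S.
have r1 u a : G (u, a) -> a - p (u - y) <= r.
  by move=> Gu; apply: ub_le_sup; [case: S0|exists (u, a)].
have r2 x b : G (x, b) -> r <= p (x + y) - b.
  move=> Gx; apply: ge_sup; first by case: S0.
  by move=> _ [[u a] Gu ->]; exact: lr.
exists [set z | exists u a t, G (u, a) /\ z = (u + t *: y, a + t * r)].
split; last by exists r, 0, 0, 1; rewrite scale1r mul1r !add0r.
- split.
  + move=> x a b [u [a' [t [Gu [xE ->]]]]] [v [b' [t' [Gv [xE' ->]]]]].
    have [tt|tt] := eqVneq t t'.
      subst t'; have uv : u = v by apply: (addIr (t *: y)); rewrite -xE -xE'.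
      by subst v; rewrite (Gf _ _ _ Gu Gv).
    have t0 : t - t' != 0 by rewrite subr_eq0.
    case: (Gy ((t - t')^-1 * (-1 * a' + b'))).
    have -> : y = (t - t')^-1 *: (-1 *: u + v).
      have -> : -1 *: u + v = (t - t') *: y.
        have -> : v = u + t *: y - t' *: y by rewrite -xE xE' addrK.
        by rewrite scaleN1r scalerBl -addrA addKr.
      by rewrite scalerA mulVf// scale1r.
    exact/GZ/Gl.
  + move=> c x a z b [u [a' [t [Gu [-> ->]]]]] [v [b' [t' [Gv [-> ->]]]]].
    exists (c *: u + v), (c * a' + b'), (c * t + t'); split; first exact: Gl.
    congr pair; last by ring.
    by rewrite scalerDr scalerDl scalerA addrACA.
  + move=> x a [u [a' [t [Gu [-> ->]]]]].
    have [t0|t0|->] := ltgtP t 0.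
    * have tn : 0 < - t by lra.
      have := r1 _ _ (GZ (- t)^-1 _ _ Gu).
      rewrite -(ler_pM2l tn) mulrBr mulrA divff ?gt_eqF// mul1r.
      have -> : - t * p ((- t)^-1 *: u - y) = p (u + t *: y).
        rewrite -{1}(gtr0_norm tn) -seminormZ scalerBr scalerA divff ?gt_eqF//.
        by rewrite scale1r scaleNr opprK.
      lra.
    * have := r2 _ _ (GZ t^-1 _ _ Gu).
      rewrite -(ler_pM2l t0) mulrBr mulrA divff ?gt_eqF// mul1r.
      have -> : t * p (t^-1 *: u + y) = p (u + t *: y).
        rewrite -{1}(gtr0_norm t0) -seminormZ scalerDr scalerA divff ?gt_eqF//.
        by rewrite scale1r.
      lra.
    * by rewrite scale0r mul0r !addr0; exact: Gp.
- by move=> [u a] Gu; exists u, a, 0; rewrite scale0r mul0r !addr0.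
Qed.

(** Zorn's lemma is applied to the sets A whose union with the graph L0 of
    t x0 |-> t p x0 is dominated: with L0 adjoined, the empty chain is bounded
    too.  A maximal graph is total by [dominated_graph_extend]. *)
Theorem hahn_banach x0 : exists f : {linear V -> R^o},
  (forall x, `|f x| <= p x) /\ f x0 = p x0.
Proof.
pose L0 := [set z : V * R | exists t, z = (t *: x0, t * p x0)].
have [|A [PA Amax]] := @Zorn_bigcup (V * R)%type
    [set A | dominated_graph (A `|` L0)].
  move=> F FP Ftot.
  have L0dom : dominated_graph L0.
    split.
    - move=> x a b [t [-> ->]] [t' [E ->]].
      have [px|px] := eqVneq (p x0) 0; first by rewrite px !mulr0.
      have : (t - t') *: x0 = 0 by rewrite scalerBl E subrr.
      move/(congr1 p)/eqP; rewrite seminormZ seminorm0 mulf_eq0 (negbTE px) orbF.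
      by rewrite normr_eq0 subr_eq0 => /eqP ->.
    - move=> c x a y b [t [-> ->]] [t' [-> ->]]; exists (c * t + t').
      by rewrite scalerDl scalerA; congr pair; ring.
    - move=> x a [t [-> ->]]; rewrite seminormZ ler_wpM2r ?ler_norm//.
      exact: seminorm_ge0.
  have sub2 z w : (\bigcup_(X in F) X `|` L0) z -> (\bigcup_(X in F) X `|` L0) w ->
      exists G, [/\ dominated_graph G, G `<=` \bigcup_(X in F) X `|` L0, G z & G w].
    have FG X : F X -> dominated_graph (X `|` L0) /\
        X `|` L0 `<=` \bigcup_(X in F) X `|` L0.
      move=> FX; split; first exact: FP.
      by move=> u [Xu|]; [left; exists X|right].
    move=> [[X FX Xz]|Lz] [[Y FY Yw]|Lw].
    - have [XY|YX] := Ftot _ _ FX FY.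
        have [? ?] := FG _ FY; exists (Y `|` L0); split => //; left => //.
        exact: XY.
      have [? ?] := FG _ FX; exists (X `|` L0); split => //; left => //.
      exact: YX.
    - have [? ?] := FG _ FX; exists (X `|` L0); split => //; [by left|by right].
    - have [? ?] := FG _ FY; exists (Y `|` L0); split => //; [by right|by left].
    - by exists L0; split => // u; right.
  split.
  - by move=> x a b /sub2 H /H[G [[Gf _ _] _ Gx Gy]]; exact: Gf Gx Gy.
  - move=> c x a y b /sub2 H /H[G [[_ Gl _] GF Gx Gy]].
    by apply: GF; exact: Gl.
  - by move=> x a xa; have [G [[_ _ Gp] _ Gx _]] := sub2 _ _ xa xa; exact: Gp.
set G := A `|` L0 in PA.
have GL0 : L0 `<=` G by move=> z; right.
have G0 : G (0, 0) by apply: GL0; exists 0; rewrite scale0r mul0r.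
have total y : exists a, G (y, a).
  apply: contrapT => /forallNP Gy.
  have [G' [G'd GG' [a G'y]]] := dominated_graph_extend PA G0 Gy.
  apply: (Amax G').
    split; first by move=> z Az; apply: GG'; left.
    by move=> E; apply: (Gy a); left; exact: E.
  rewrite /= (_ : G' `|` L0 = G')//; apply/setUidPl.
  by apply: subset_trans GG'.
have /choice[f Gf] := total.
have [Gfun Gl Gp] := PA.
have flin : linear (f : V -> R^o).
  by move=> c x y; apply: (Gfun (c *: x + y));
    [exact: Gf|exact: (Gl c x _ y _ (Gf x) (Gf y))].
pose g : {linear V -> R^o} :=
  HB.pack (f : V -> R^o) (GRing.isLinear.Build R V R^o *:%R _ flin).
exists g.
split => /= [x|]; last first.
  by apply: (Gfun x0); [exact: Gf|apply: GL0; exists 1; rewrite scale1r mul1r].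
rewrite ler_norml (Gp _ _ (Gf x)) andbT lerNl.
have -> : - f x = f (- x).
  apply: (Gfun (- x)); last exact: Gf.
  by have := Gl (-1) _ _ _ _ (Gf x) G0; rewrite scaleN1r mulN1r !addr0.
rewrite (_ : p x = p (- x)); first exact: Gp (Gf _).
by rewrite -scaleN1r seminormZ normrN1 mul1r.
Qed.

End HahnBanach.

(** * Biorthogonal systems in infinite dimension *)

Definition norm_seminorm (R : realType) (X : normedModType R) : seminorm X :=
  Seminorm (@ler_normD R X) (@normrZ R X).

Definition bounded_functional (R : realType) (X : normedModType R) (f : X -> R) :=
  linear (f : X -> R^o) /\ exists M, forall x, `|f x| <= M * `|x|.

Lemma norming_functional (R : realType) (X : normedModType R) (x : X) :
  exists f : X -> R, [/\ linear (f : X -> R^o), forall y, `|f y| <= `|y| & f x = `|x|].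
Proof.
have [f [fp fx]] := hahn_banach (norm_seminorm X) x.
by exists f; split => // a u v; rewrite linearP.
Qed.

(** One step of the induction takes x outside the span of the b_i, replaces it
    by x' = x - sum_i phi_i(x) b_i, on which all phi_i vanish, and corrects a
    functional norming x' so that it vanishes on all b_i. *)
Lemma biorthogonal_system (R : realType) (X : normedModType R) (n : nat) :
  ~ finite_dimensional X ->
  exists (b : nat -> X) (phi : nat -> X -> R),
    (forall i, bounded_functional (phi i)) /\
    forall i j, (i < n)%N -> (j < n)%N -> phi i (b j) = (i == j)%:R.
Proof.
move=> Xinf; elim: n => [|n [b [phi [phib phiP]]]].
  exists (fun=> 0), (fun=> cst 0); split => // i; split => [a x y|].
    by rewrite /= scaler0 addr0.
  by exists 0 => x; rewrite normr0 mul0r.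
have phiD i a x y : phi i (a *: x + y) = a * phi i x + phi i y.
  by case: (phib i) => H _; exact: H.
have phi_sum i (c : 'I_n -> R) : (i < n)%N ->
    phi i (\sum_(k < n) c k *: b k) = \sum_(k < n) c k * (i == k)%:R.
  move=> ilt; have phi0 : phi i 0 = 0.
    by have := phiD i (-1) 0 0; rewrite scaler0 addr0 mulN1r addNr.
  have E (r : seq 'I_n) : phi i (\sum_(k <- r) c k *: b k) =
      \sum_(k <- r) c k * (i == k)%:R.
    elim: r => [|k r IH]; first by rewrite !big_nil.
    by rewrite !big_cons phiD IH phiP.
  exact: E.
have [x Hx] : exists x : X, forall a : 'I_n -> R, x <> \sum_(i < n) a i *: b i.
  apply: contrapT => /forallNP H; apply: Xinf.
  exists n, (fun i => b i); apply/seteqP; split => // x _.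
  have /existsNP[a /contrapT xa] := H x.
  by exists a.
pose x' := x - \sum_(i < n) phi i x *: b i.
have x'0 : x' != 0 by rewrite subr_eq0; apply/eqP; exact: Hx.
have phix' i : (i < n)%N -> phi i x' = 0.
  move=> ilt; rewrite /x' addrC -scaleN1r phiD phi_sum//.
  rewrite (bigD1 (Ordinal ilt))//= eqxx mulr1 big1 ?addr0; first by rewrite mulN1r addNr.
  by move=> k kn; rewrite (_ : (i == k) = false) ?mulr0// eq_sym; apply: negbTE.
have [psi [psil psin psix]] := norming_functional x'.
have psiD a u v : psi (a *: u + v) = a * psi u + psi v by exact: psil.
have x'n : `|x'| != 0 by rewrite normr_eq0.
pose chi u := `|x'|^-1 * (psi u - \sum_(i < n) psi (b i) * phi i u).
exists (fun k => if k == n then x' else b k), (fun k => if k == n then chi else phi k).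
split.
- move=> i; case: ifP => // _; split => [a u v|].
    change (chi (a *: u + v) = a * chi u + chi v); rewrite /chi psiD.
    rewrite (_ : \sum_(k < n) psi (b k) * phi k (a *: u + v) =
      a * \sum_(k < n) psi (b k) * phi k u + \sum_(k < n) psi (b k) * phi k v).
      by ring.
    rewrite mulr_sumr -big_split; apply: eq_bigr => k _; rewrite phiD /=.
    by ring.
  have /choice[M HM] : forall i, exists M, forall u, `|phi i u| <= M * `|u|.
    by move=> k; case: (phib k).
  exists (`|x'|^-1 * (1 + \sum_(k < n) `|psi (b k)| * M k)) => u.
  rewrite normrM normfV normr_id -mulrA ler_wpM2l ?invr_ge0//.
  rewrite mulrDl mul1r (le_trans (ler_normB _ _))// lerD//.
  rewrite mulr_suml (le_trans (ler_norm_sum _ _ _))// ler_sum// => k _.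
  by rewrite normrM -mulrA ler_wpM2l.
- move=> i j; rewrite !ltnS => ile jle.
  have ltn_neq k : (k <= n)%N -> k != n -> (k < n)%N.
    by move=> ? ?; rewrite ltn_neqAle; apply/andP.
  case: ifPn => [/eqP ->|ine]; case: ifPn => [/eqP ->|jne].
  + by rewrite eqxx /chi psix big1 ?subr0 ?mulVf// => k _; rewrite phix' ?mulr0.
  + have jn := ltn_neq _ jle jne.
    rewrite eq_sym (negbTE jne) /chi (bigD1 (Ordinal jn))//= phiP// eqxx mulr1.
    rewrite big1 ?addr0 ?subrr ?mulr0// => k kj; rewrite phiP//.
    by rewrite (_ : (_ == _) = false) ?mulr0//; apply: negbTE.
  + by rewrite (negbTE ine) phix'// ltn_neq.
  + by rewrite phiP// ltn_neq.
Qed.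

(** On a biorthogonal system the Gram matrix of c sum_i phi_i(x) phi_i(y) is the
    scalar matrix c. *)
Lemma contractive_posdet (R : realType) (X : normedModType R) (n : nat) :
  ~ finite_dimensional X ->
  exists b : 'I_n -> X, exists2 q, contractive q & 0 < \det (gram q b).
Proof.
move=> /(biorthogonal_system n)[b [phi [phib phiP]]].
have /choice[M HM] : forall i, exists M, forall u, `|phi i u| <= M * `|u|.
  by move=> k; case: (phib k).
pose c := (1 + \sum_(i < n) M i ^+ 2)^-1.
have M0 : 0 <= \sum_(i < n) M i ^+ 2 by apply: sumr_ge0 => i _; exact: sqr_ge0.
have c0 : 0 < c by rewrite invr_gt0; lra.
exists (fun i => b i), (fun x y => c * \sum_(i < n) phi i x * phi i y).
  split; first split.
  - by move=> x y; congr (_ * _); apply: eq_bigr => i _; rewrite mulrC.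
  - move=> a x y z; rewrite mulrCA -mulrDr; congr (_ * _).
    rewrite mulr_sumr -big_split /=; apply: eq_bigr => i _.
    by case: (phib i) => /(_ a y z) -> _; rewrite mulrDr mulrCA.
  - move=> x; rewrite mulr_ge0 ?(ltW c0)// sumr_ge0// => i _.
    by rewrite -expr2 sqr_ge0.
  move=> x; rewrite mulrC ler_pdivrMr; last lra.
  rewrite mulrDr mulr1 mulr_sumr -[X in X <= _]add0r lerD ?sqr_ge0// ler_sum// => i _.
  rewrite -expr2 -[leLHS]real_normK ?num_real// mulrC -exprMn.
  by rewrite lerXn2r ?nnegrE// (le_trans _ (HM i x)).
have -> : gram (fun x y => c * \sum_(i < n) phi i x * phi i y)
    (fun i : 'I_n => b i) = c%:M.
  apply/matrixP => i j; rewrite !mxE (bigD1 i)//= !phiP// eqxx mul1r.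
  rewrite big1 ?addr0 ?mulr_natr// => k ki.
  by rewrite phiP// (_ : (_ == _) = false) ?mul0r//; apply: negbTE.
by rewrite det_scalar exprn_gt0.
Qed.

(** * Finite-dimensional subspaces *)

Lemma bounded_linear_cts (R : realType) (V W : normedModType R) (f : V -> W) M :
  linear f -> (forall x, `|f x| <= M * `|x|) -> continuous f.
Proof.
move=> fl fM x; apply/cvgrPdist_lt => e e0.
have M1 : 0 < `|M| + 1 by rewrite ltr_wpDl.
near=> y.
have -> : f x - f y = f (x - y).
  by have := fl (-1) y x; rewrite !scaleN1r [- f y + _]addrC [- y + _]addrC.
apply: le_lt_trans (fM _) _; apply: (@le_lt_trans _ _ ((`|M| + 1) * `|x - y|)).
  by apply: ler_wpM2r => //; have := ler_norm M; lra.
rewrite mulrC -ltr_pdivlMr//; near: y.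
by apply: cvgr_dist_lt => //; rewrite divr_gt0.
Unshelve. all: by end_near. Qed.

Section LinearCombinations.
Context (R : realType) (n : nat).
Implicit Type a : 'rV[R]_n.

(** Coefficients are row vectors rather than functions because row vectors carry
    a norm whose unit sphere is known to be compact. *)
Definition lcomb (V : lmodType R) (b : 'I_n -> V) a := \sum_i a 0 i *: b i.

Lemma lcomb_linear (V : lmodType R) (b : 'I_n -> V) : linear (lcomb b).
Proof.
move=> t u v; rewrite /lcomb scaler_sumr -big_split /=; apply: eq_bigr => i _.
by rewrite !mxE scalerDl scalerA.
Qed.
HB.instance Definition _ (V : lmodType R) (b : 'I_n -> V) :=
  GRing.isLinear.Build R 'rV[R]_n V *:%R (lcomb b) (lcomb_linear b).

Lemma lcombB (V : lmodType R) (b b' : 'I_n -> V) a :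
  lcomb b a - lcomb b' a = lcomb (fun i => b i - b' i) a.
Proof.
by rewrite /lcomb -sumrB; apply: eq_bigr => i _; rewrite scalerBr.
Qed.

Lemma linear_lcomb (V W : lmodType R) (f : {linear V -> W}) (b : 'I_n -> V) a :
  f (lcomb b a) = lcomb (f \o b) a.
Proof.
by rewrite /lcomb linear_sum; apply: eq_bigr => i _; rewrite linearZ.
Qed.

Lemma coord_le_norm a i : `|a 0 i| <= `|a|.
Proof.
have -> : `|a| = mx_norm a by [].
rewrite mx_normrE.
by apply: (le_trans _ (le_bigmax _ _ (0, i))).
Qed.

Lemma seminorm_lcomb (V : lmodType R) (p : seminorm V) (b : 'I_n -> V) a :
  p (lcomb b a) <= `|a| * \sum_i p (b i).
Proof.
have E (r : seq 'I_n) : p (\sum_(i <- r) a 0 i *: b i) <= `|a| * \sum_(i <- r) p (b i).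
  elim: r => [|i r IH]; first by rewrite !big_nil seminorm0 mulr0.
  rewrite !big_cons mulrDr (le_trans (seminormD _ _ _))// lerD//.
  by rewrite seminormZ ler_wpM2r ?coord_le_norm// seminorm_ge0.
exact: E.
Qed.

Lemma normr_lcomb (V : normedModType R) (b : 'I_n -> V) a :
  `|lcomb b a| <= `|a| * \sum_i `|b i|.
Proof. exact: (seminorm_lcomb (norm_seminorm V)). Qed.

Lemma sphere_compact : compact [set a : 'rV[R]_n | `|a| = 1].
Proof.
apply: bounded_closed_compact.
  by exists 1; split => // M M1 a /= ->; exact: ltW.
apply: (@preimage_closed _ _ (fun a : 'rV[R]_n => `|a|) [set 1]).
  by move=> a _; exact: norm_continuous.
exact: closed_eq.
Qed.

Lemma on_sphere (P : 'rV[R]_n -> Prop) :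
  (forall a, `|a| = 1 -> P a) -> P 0 -> (forall t a, 0 < t -> P a -> P (t *: a)) ->
  forall a, P a.
Proof.
move=> P1 P0 PZ a; have [->//|a0] := eqVneq a 0.
have an : `|a| != 0 by rewrite normr_eq0.
have -> : a = `|a| *: (`|a|^-1 *: a) by rewrite scalerA divff// scale1r.
apply: PZ; first by rewrite normr_gt0.
by apply: P1; rewrite normrZ normfV normr_id mulVf.
Qed.

(** All norms on a finite-dimensional space are equivalent: the norm of the
    combination attains a positive minimum on the sphere of coefficients. *)
Lemma lcomb_lower_bound (V : normedModType R) (b : 'I_n -> V) :
  (forall a, lcomb b a = 0 -> a = 0) ->
  exists2 c, 0 < c & forall a, c * `|a| <= `|lcomb b a|.
Proof.
move=> bfree; pose S := [set a : 'rV[R]_n | `|a| = 1].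
have [[a0 Sa0]|S0] := pselect (S !=set0); last first.
  exists 1 => //; apply: on_sphere.
  - by move=> a a1; case: S0; exists a.
  - by rewrite normr0 mulr0.
  - by move=> t a t0 H; rewrite linearZ/= !normrZ mulrCA ler_wpM2l.
have hc : continuous (fun a => `|lcomb b a|).
  move=> a; apply: continuous_comp; last exact: norm_continuous.
  apply: (bounded_linear_cts (M := \sum_i `|b i|)); first exact: lcomb_linear.
  by move=> {}a; rewrite mulrC normr_lcomb.
have [a1] := EVT_min_rV (ex_intro _ a0 Sa0) sphere_compact
  (continuous_subspaceT hc).
rewrite inE /= => a11 Hmin.
exists `|lcomb b a1|.
  rewrite normr_gt0; apply/eqP => /bfree a10.
  by move: a11; rewrite a10 normr0 => /esym/eqP; rewrite oner_eq0.
apply: on_sphere.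
- by move=> a an; rewrite an mulr1; apply: Hmin; rewrite inE.
- by rewrite normr0 mulr0.
- by move=> t a t0 H; rewrite linearZ/= !normrZ mulrCA ler_wpM2l.
Qed.

End LinearCombinations.

(** A generating family of least length is free. *)
Lemma findim_basis (R : realType) (V : lmodType R) (E : set V) :
  findim_subspace E -> exists (n : nat) (b : 'I_n -> V),
  E = range (lcomb b) /\ forall a, lcomb b a = 0 -> a = 0.
Proof.
pose P n := `[< exists b : 'I_n -> V, E = range (lcomb b) >].
move=> [n [b Eb]]; have exP : exists n, P n.
  exists n; apply/asboolP; exists b; rewrite Eb; apply/seteqP; split.
    move=> _ [a _ <-]; exists (\row_i a i) => //.
    by apply: eq_bigr => i _; rewrite mxE.
  by move=> _ [a _ <-]; exists (fun i => a 0 i).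
have [m /asboolP[{}b {}Eb] mmin] := ex_minnP exP.
exists m, b; split => // a ab; apply: contrapT => a0.
have [k ak] : exists k, a 0 k != 0.
  apply: contrapT => /forallNP H; apply: a0; apply/rowP => k; rewrite mxE.
  by apply/eqP; apply: contrapT => /negP; exact: H.
case: m b Eb mmin a ab {a0} k ak => [|m] b Eb mmin a ab k ak; first by case: k ak.
suff /mmin : P m by rewrite ltnn.
apply/asboolP; exists (b \o lift k); rewrite Eb; apply/seteqP; split.
  move=> _ [c _ <-].
  pose d := c - (c 0 k / a 0 k) *: a.
  have -> : lcomb b c = lcomb b d by rewrite linearB linearZ/= ab scaler0 subr0.
  exists (\row_i d 0 (lift k i)) => //.
  rewrite /lcomb [in RHS](bigD1_ord k)//= [X in X *: b k](_ : _ = 0); last first.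
    by rewrite !mxE divfK ?subrr.
  by rewrite scale0r add0r; apply: eq_bigr => i _; rewrite mxE.
move=> _ [c _ <-].
exists (\row_i if unlift k i is Some j then c 0 j else 0) => //.
rewrite /lcomb (bigD1_ord k)//= mxE unlift_none scale0r add0r.
by apply: eq_bigr => i _; rewrite mxE liftK.
Qed.

Lemma findim_range_lcomb (R : realType) (V : lmodType R) n (b : 'I_n -> V) :
  findim_subspace (range (lcomb b)).
Proof.
exists n, b; apply/seteqP; split.
  by move=> _ [a _ <-]; exists (fun i => a 0 i).
move=> _ [a _ <-]; exists (\row_i a i) => //.
by apply: eq_bigr => j _; rewrite mxE.
Qed.

Lemma opnorm_bounds (R : realType) (V W : normedModType R) (E : set V)
    (f : V -> W) M : E 0 -> (forall x, E x -> `|x| <= 1 -> `|f x| <= M) ->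
  0 <= opnorm E f <= M.
Proof.
move=> E0 fM; apply/andP; split.
  apply: (@le_trans _ _ `|f 0|) => //; apply: ub_le_sup.
    by exists M => _ [x [Ex x1] <-]; exact: fM.
  by exists 0 => //; split => //=; rewrite normr0.
apply: ge_sup; first by exists `|f 0|, 0 => //; split => //=; rewrite normr0.
by move=> _ [x [Ex x1] <-]; exact: fM.
Qed.

(** * Limits of seminorms along ultrafilters *)

(** The image of the ultrafilter has a cluster point in the compact interval
    [- M, M], and an ultrafilter converges to its cluster points. *)
Lemma ultra_bounded_cvg (R : realType) (I : Type) (U : set_system I)
    (f : I -> R) M : UltraFilter U -> (\forall i \near U, `|f i| <= M) ->
  cvg (f i @[i --> U]).
Proof.
move=> UU fM; apply/cvg_ex.
have FM : (f i @[i --> U]) [set` `[- M, M]].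
  by apply: filterS fM => i /=; rewrite in_itv /= ler_norml.
have [l [_ Hl]] := @segment_compact R (- M) M _ (fmap_proper_filter _ _) FM.
exists l; apply/cvgrPdist_lt => e e0.
have [//|nU] := in_ultra_setVsetC [set i | `|l - f i| < e] UU.
have : (f i @[i --> U]) [set y | ~ `|l - y| < e] by exact: nU.
move=> /Hl /(_ (nbhsx_ballx l e e0))[y [/= ney]].
by rewrite -ball_normE.
Qed.

Lemma le_cvg_near (R : realType) (I : Type) (F : set_system I)
    (f g : I -> R) l l' : ProperFilter F -> f i @[i --> F] --> l ->
  g i @[i --> F] --> l' -> (\forall i \near F, f i <= g i) -> l <= l'.
Proof.
move=> FF fl gl fg; rewrite -subr_ge0; apply: (cvgr_to_ge (cvgB gl fl)).
by apply: filterS fg => i; rewrite -subr_ge0.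
Qed.

Lemma cvg_sum_ord (R : realType) (I : Type) (F : set_system I) n
    (f : 'I_n -> I -> R) (l : 'I_n -> R) : Filter F ->
  (forall k, f k i @[i --> F] --> l k) ->
  (fun i => \sum_k f k i) @ F --> \sum_k l k.
Proof.
move=> FF fl.
have E (r : seq 'I_n) : (fun i => \sum_(k <- r) f k i) @ F --> \sum_(k <- r) l k.
  elim: r => [|k r IH].
    rewrite big_nil; under eq_fun do rewrite big_nil; exact: cvg_cst.
  rewrite big_cons; under eq_fun do rewrite big_cons; exact: cvgD (fl k) IH.
exact: E.
Qed.

(** The maps T i are linear only in the limit: each instance of linearity holds
    for U-almost all i.  This covers maps that are linear on an increasing net of
    finite-dimensional subspaces. *)
Section LimitSeminorm.
Context (R : realType) (I : Type) (U : set_system I).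
Context (Z : lmodType R) (V : normedModType R) (T : I -> Z -> V).
Hypothesis Tlin : forall a x y,
  \forall i \near U, T i (a *: x + y) = a *: T i x + T i y.

Lemma limit_seminorm : UltraFilter U ->
  (forall z, exists M, \forall i \near U, `|T i z| <= M) ->
  exists p : seminorm Z, forall z, `|T i z| @[i --> U] --> p z.
Proof.
move=> UU Tbnd.
have Tcvg z : cvg (`|T i z| @[i --> U]).
  have [M TM] := Tbnd z; apply: (ultra_bounded_cvg (M := M)).
  by apply: filterS TM => i; rewrite normr_id.
pose p z := lim (`|T i z| @[i --> U]).
have pcvg z : `|T i z| @[i --> U] --> p z by exact: Tcvg.
have pD x y : p (x + y) <= p x + p y.
  apply: le_cvg_near (pcvg (x + y)) (cvgD (pcvg x) (pcvg y)) _.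
  apply: filterS (Tlin 1 x y) => i; rewrite !scale1r => ->.
  exact: ler_normD.
have T0 : \forall i \near U, T i 0 = 0.
  apply: filterS (Tlin (-1) 0 0) => i; rewrite scaler0 addr0 => ->.
  by rewrite scaleN1r addNr.
have pZ a x : p (a *: x) = `|a| * p x.
  have E : \forall i \near U, `|T i (a *: x)| = `|a| * `|T i x|.
    apply: filterS2 (Tlin a x 0) T0 => i; rewrite addr0 => -> ->.
    by rewrite addr0 normrZ.
  have H : `|a| * `|T i x| @[i --> U] --> `|a| * p x by exact: cvgMr (pcvg x).
  apply/eqP; rewrite eq_le; apply/andP; split.
    by apply: le_cvg_near (pcvg _) H _; apply: filterS E => i ->.
  by apply: le_cvg_near H (pcvg _) _; apply: filterS E => i ->.
by exists (Seminorm pD pZ).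
Qed.

Context (FU : ProperFilter U) (p : seminorm Z).
Hypothesis Tcvg : forall z, `|T i z| @[i --> U] --> p z.

Lemma near_lcomb n (z : 'I_n -> Z) (a : 'rV[R]_n) :
  \forall i \near U, T i (lcomb z a) = lcomb (T i \o z) a.
Proof.
have E (r : seq 'I_n) : \forall i \near U, T i (\sum_(k <- r) a 0 k *: z k) =
    \sum_(k <- r) a 0 k *: T i (z k).
  elim: r => [|k r IH].
    apply: filterS (Tlin (-1) 0 0) => i; rewrite !big_nil scaler0 addr0 => ->.
    by rewrite scaleN1r addNr.
  apply: filterS2 IH (Tlin (a 0 k) (z k) (\sum_(k <- r) a 0 k *: z k)) => i IH H.
  by rewrite !big_cons H IH.
exact: E.
Qed.

(** The maps a |-> |lcomb (T i \o z) a| are uniformly Lipschitz in a for almost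
    all i, which upgrades pointwise convergence to uniform convergence on the
    compact sphere. *)
Lemma uniform_on_sphere n (z : 'I_n -> Z) (e : R) : 0 < e ->
  \forall i \near U, forall a : 'rV[R]_n, `|a| = 1 ->
    `| `|lcomb (T i \o z) a| - p (lcomb z a)| <= e.
Proof.
move=> e0; pose M := 1 + \sum_k (p (z k) + 1).
have M1 : 1 <= M.
  by rewrite lerDl sumr_ge0// => k _; rewrite addr_ge0// seminorm_ge0.
have bnd : \forall i \near U, \sum_k `|T i (z k)| <= M.
  suff : \forall i \near U, forall k, `|T i (z k)| <= p (z k) + 1.
    apply: filterS => i H; apply: (@le_trans _ _ (\sum_k (p (z k) + 1))).
      exact: ler_sum.
    by rewrite lerDr.
  apply: filter_forall => k; move/cvgrPdist_lt: (@Tcvg (z k)) => /(_ 1 ltr01).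
  by apply: filterS => i; rewrite ltr_norml => /andP[? ?]; lra.
have pM : \sum_k p (z k) <= M.
  apply: (@le_trans _ _ (\sum_k (p (z k) + 1))); last by rewrite lerDr.
  by apply: ler_sum => k _; rewrite lerDl.
have := @compact_near_coveringP _ [set a : 'rV[R]_n | `|a| = 1].
case=> /(_ (sphere_compact (n := n))) cov _.
apply: (cov _ U (fun i a => `| `|lcomb (T i \o z) a| - p (lcomb z a)| <= e)).
move=> a _; have e3 : 0 < e / 3 by lra.
exists ([set a' | `|a - a'| < e / 3 / M],
  [set i | [/\ T i (lcomb z a) = lcomb (T i \o z) a,
     `|p (lcomb z a) - `|T i (lcomb z a)| | < e / 3 &
     \sum_k `|T i (z k)| <= M]]).
  split => /=.
    apply/nbhs_ballP; exists (e / 3 / M) => /=; first by rewrite divr_gt0//; lra.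
    by move=> a'; rewrite -ball_normE.
  have C : \forall i \near U, `|p (lcomb z a) - `|T i (lcomb z a)| | < e / 3.
    by move/cvgrPdist_lt : (@Tcvg (lcomb z a)); apply.
  by apply: filterS3 (near_lcomb z a) C bnd => i.
move=> [a' i] /= [aa' [Ta Tp TM]].
have aM : `|a - a'| * M <= e / 3.
  by rewrite -ler_pdivlMr; [exact: ltW|lra].
have h1 : `| `|lcomb (T i \o z) a| - `|lcomb (T i \o z) a'| | <= e / 3.
  apply: le_trans (ler_dist_dist _ _) _; rewrite -linearB.
  apply: le_trans (normr_lcomb _ _) _; apply: le_trans aM.
  exact: ler_wpM2l.
have h2 : `|p (lcomb z a) - p (lcomb z a')| <= e / 3.
  have pB u v : p u - p v <= p (u - v).
    by have := seminormD p (u - v) v; rewrite subrK; lra.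
  have pS u v : p (u - v) = p (v - u).
    by rewrite -[u - v]opprB -[- (v - u)]scaleN1r seminormZ normrN1 mul1r.
  have : p (lcomb z a - lcomb z a') <= e / 3.
    rewrite -linearB; apply: le_trans (seminorm_lcomb _ _ _) _.
    by apply: le_trans aM; exact: ler_wpM2l.
  rewrite ler_norml; have := pB (lcomb z a) (lcomb z a').
  have := pB (lcomb z a') (lcomb z a); rewrite (pS _ (lcomb z a)).
  by move=> *; apply/andP; split; lra.
move: h1 h2 Tp; rewrite Ta !ler_norml ltr_norml => /andP[? ?] /andP[? ?] /andP[? ?].
by apply/andP; split; lra.
Qed.

(** A basis b of E is approximated by vectors z_j of Z; for a suitable i the map
    b_j |-> T i (z_j) distorts norms by a factor between 1 - d and 1 + d. *)
Theorem completion_finitely_representable :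
  finitely_representable (completion p) V.
Proof.
move=> E e /findim_basis[n [b [EE bfree]]] e0.
have [c c0 cb] := lcomb_lower_bound bfree.
(* chosen so that (1 + d) / (1 - d) = 1 + e *)
pose d := e / (2 + e).
have d0 : 0 < d by rewrite divr_gt0//; lra.
have de : d * (2 + e) = e by rewrite divfK// gt_eqF//; lra.
have d1 : d < 1 by nra.
pose k := d * c / 2.
have k0 : 0 < k by rewrite divr_gt0// mulr_gt0.
have /choice[z zb] : forall i, exists z, `|b i - completion_in p z| < k / n.+1%:R.
  by move=> i; apply: completion_in_dense; rewrite divr_gt0.
have hb a : `| `|lcomb b a| - p (lcomb z a)| <= `|a| * k.
  rewrite -(completion_in_norm p) linear_lcomb.
  apply: le_trans (ler_dist_dist _ _) _; rewrite lcombB.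
  apply: le_trans (normr_lcomb _ _) _; apply: ler_wpM2l => //.
  apply: (@le_trans _ _ (\sum_(i < n) k / n.+1%:R)).
    by apply: ler_sum => i _; exact/ltW/zb.
  rewrite sumr_const card_ord -[leLHS]mulr_natr mulrAC ler_pdivrMr//.
  by rewrite ler_wpM2l ?(ltW k0)// ler_nat.
have [i Ti] := filter_ex (uniform_on_sphere z k0).
pose t j := T i (z j).
have {}Ti a : `| `|lcomb t a| - `|lcomb b a| | <= d * `|lcomb b a|.
  move: a; apply: on_sphere.
  - move=> a a1; apply: (@le_trans _ _ (d * c)).
      have := Ti _ a1; have := hb a; rewrite a1 mul1r -/t.
      rewrite (_ : lcomb (T i \o z) a = lcomb t a)// !ler_norml.
      have kk : k + k = d * c by rewrite /k; lra.
      by move=> /andP[? ?] /andP[? ?]; apply/andP; split; lra.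
    by rewrite ler_wpM2l ?(ltW d0)//; have := cb a; rewrite a1 mulr1.
  - by rewrite !linear0 !normr0 subrr normr0 mulr0.
  - move=> s a s0 H; rewrite !linearZ/= !normrZ -mulrBr normrM normr_id.
    by rewrite mulrCA ler_wpM2l.
have tle a : `|lcomb t a| <= (1 + d) * `|lcomb b a|.
  by have := Ti a; rewrite ler_norml => /andP[_]; lra.
have tge a : (1 - d) * `|lcomb b a| <= `|lcomb t a|.
  by have := Ti a; rewrite ler_norml => /andP[+ _]; lra.
have d1' : 0 < 1 - d by lra.
have tfree a : lcomb t a = 0 -> a = 0.
  move=> ta; apply: bfree; apply/eqP; rewrite -normr_le0.
  by have := tge a; rewrite ta normr0 pmulr_rle0.
have binj a a' : lcomb b a = lcomb b a' -> a = a'.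
  by move=> h; apply/eqP; rewrite -subr_eq0; apply/eqP/bfree; rewrite linearB/= h subrr.
have tinj a a' : lcomb t a = lcomb t a' -> a = a'.
  by move=> h; apply/eqP; rewrite -subr_eq0; apply/eqP/tfree; rewrite linearB/= h subrr.
have /choice[cb' cbP] : forall x, exists a, E x -> x = lcomb b a.
  move=> x; have [Ex|] := pselect (E x); last by exists 0.
  by move: Ex; rewrite EE => -[a _ <-]; exists a.
pose F := range (lcomb t).
have /choice[ct ctP] : forall y, exists a, F y -> y = lcomb t a.
  move=> y; have [Fy|] := pselect (F y); last by exists 0.
  by case: Fy => a _ <-; exists a.
have Eb a : E (lcomb b a) by rewrite EE; exists a.
have Ft a : F (lcomb t a) by exists a.
have cbK a : cb' (lcomb b a) = a by apply: binj; rewrite -cbP.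
have ctK a : ct (lcomb t a) = a by apply: tinj; rewrite -ctP.
exists F, (fun x => lcomb t (cb' x)), (fun y => lcomb b (ct y)); split.
- exact: findim_range_lcomb.
- move=> a x y; rewrite {1}EE => -[u _ <-]; rewrite {1}EE => -[v _ <-].
  by rewrite -linearP !cbK linearP.
- split.
  + by move=> x _; exact: Ft.
  + move=> x y /set_mem; rewrite {1}EE => -[u _ <-] /set_mem.
    rewrite {1}EE => -[v _ <-].
    by rewrite !cbK => /tinj ->.
  + by move=> _ [a _ <-]; exists (lcomb b a) => //; rewrite cbK.
- move=> x /set_mem; rewrite {1}EE => -[u _ <-].
  by rewrite cbK ctK.
have /andP[T0 T1] : 0 <= opnorm E (fun x => lcomb t (cb' x)) <= 1 + d.
  apply: opnorm_bounds => [|x]; first by rewrite -[0](linear0 (lcomb b)); exact: Eb.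
  rewrite {1}EE => -[a _ <-] b1; rewrite cbK; apply: le_trans (tle a) _.
  by rewrite ger_pMr//; lra.
have /andP[S0 S1] : 0 <= opnorm F (fun y => lcomb b (ct y)) <= (1 - d)^-1.
  apply: opnorm_bounds => [|y]; first by rewrite -[0](linear0 (lcomb t)); exact: Ft.
  case=> a _ <- t1; rewrite ctK -[leRHS]mul1r ler_pdivlMr// mulrC.
  exact: le_trans (tge a) t1.
apply: le_trans (ler_pM T0 S0 T1 S1) _; rewrite ler_pdivrMr//; nra.
Qed.

End LimitSeminorm.

(** * Extension to completions and tensor products *)

Section CompletionExtension.
Context (R : realType) (Z : lmodType R) (p : seminorm Z).
Context (B : completeNormedModType R) (f : {linear Z -> B}) (M : R).
Hypothesis M0 : 0 <= M.
Hypothesis fM : forall z, `|f z| <= M * p z.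

(** The inequalities for all z determine y, because the image of Z is dense;
    linearity of the extension follows from this uniqueness. *)
Lemma completion_near_extension (x : completion p) :
  exists y : B, forall z, `|y - f z| <= M * `|x - completion_in p z|.
Proof.
have M0' := M0.
have [d [d0 small]] : exists d : nat -> R, (forall n, 0 < d n) /\
    forall e, 0 < e -> \forall n \near \oo, M * d n < e.
  exists (fun n => n.+1%:R^-1); split=> [n|e e0]; first by rewrite invr_gt0.
  have M1 : 0 < M + 1 by lra.
  have [N _ HN] := near_infty_natSinv_lt (PosNum (divr_gt0 e0 M1)).
  exists N => // n /= /HN /=; rewrite ltr_pdivlMr// => h.
  by apply: le_lt_trans h; rewrite mulrC ler_wpM2l ?invr_ge0//; lra.
have /choice[v xv] : forall n, exists v, `|x - completion_in p v| < d n.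
  by move=> n; exact: completion_in_dense.
have vz n z : `|f (v n) - f z| <= M * (`|x - completion_in p z| + d n).
  rewrite -linearB; apply: le_trans (fM _) _; apply: ler_wpM2l => //.
  rewrite -(completion_in_norm p) linearB/=.
  have := ler_distD x (completion_in p (v n)) (completion_in p z).
  by rewrite [`|completion_in p (v n) - x|]distrC; have := xv n; lra.
have /cvg_ex[y fy] : cvg ((f \o v) @ \oo).
  apply/cauchy_cvgP/cauchy_exP => e e0.
  have [N _ HN] := small _ (divr_gt0 e0 (ltr0n _ 2)).
  exists (f (v N)); exists N => // n /= Nn.
  rewrite -ball_normE /= distrC; apply: le_lt_trans (vz n (v N)) _.
  have := HN n Nn; have := HN N (leqnn N); rewrite /= mulrDr => h1 h2.
  have := ler_wpM2l M0 (ltW (xv N)); lra.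
exists y => z; apply/ler_addgt0Pr => e e0.
have [N _ HN] := small _ (divr_gt0 e0 (ltr0n _ 2)).
move/cvgrPdist_lt: fy => /(_ _ (divr_gt0 e0 (ltr0n _ 2)))[K _ HK].
pose n := maxn N K.
have := HN n (leq_maxl _ _); have := HK n (leq_maxr _ _) => /=.
have := vz n z; rewrite mulrDr; have := ler_distD (f (v n)) y (f z); lra.
Qed.

Lemma completion_extension : exists F : {linear completion p -> B},
  (forall z, F (completion_in p z) = f z) /\ (forall x, `|F x| <= M * `|x|).
Proof.
have M0' := M0.
have /choice[F HF] := completion_near_extension.
have Fin z : F (completion_in p z) = f z.
  have := HF (completion_in p z) z; rewrite subrr normr0 mulr0 normr_le0 subr_eq0.
  by move/eqP.
have Flin : linear F.
  move=> a x y; apply/eqP; rewrite -subr_eq0 -normr_le0.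
  apply/ler_addgt0Pr => e e0; rewrite add0r.
  have c0 : 0 < 2 * (M + 1) * (`|a| + 1) by rewrite !mulr_gt0//; have := normr_ge0 a; lra.
  pose d := e / (2 * (M + 1) * (`|a| + 1)).
  have d0 : 0 < d by rewrite divr_gt0.
  have de : 2 * (M + 1) * (`|a| + 1) * d = e by rewrite mulrC divfK// gt_eqF.
  have [z xz] := completion_in_dense x d0.
  have [w yw] := completion_in_dense y d0.
  have H1 := HF (a *: x + y) (a *: z + w).
  have H2 := HF x z; have H3 := HF y w.
  have E : `|a *: x + y - completion_in p (a *: z + w)| <= `|a| * d + d.
    rewrite linearP/= opprD addrACA -scalerBr; apply: le_trans (ler_normD _ _) _.
    by rewrite normrZ lerD ?(ltW yw)// ler_wpM2l ?(ltW xz).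
  have -> : F (a *: x + y) - (a *: F x + F y) =
    (F (a *: x + y) - f (a *: z + w)) - (a *: (F x - f z) + (F y - f w)).
    by rewrite linearP/= scalerBr addrACA -opprD opprB addrA subrK.
  apply: le_trans (ler_normB _ _) _.
  apply: (@le_trans _ _ (M * (`|a| * d + d) + (`|a| * (M * d) + M * d))).
    apply: lerD; first by apply: le_trans H1 _; rewrite ler_wpM2l.
    apply: le_trans (ler_normD _ _) _; apply: lerD.
      rewrite normrZ ler_wpM2l//; apply: le_trans H2 _; rewrite ler_wpM2l//.
      exact: ltW.
    by apply: le_trans H3 _; rewrite ler_wpM2l// ltW.
  rewrite -de; have := normr_ge0 a; move: d0; move: (`|a|) => A d0 A0.
  have : 0 <= A * d by rewrite mulr_ge0// ltW.
  nra.
pose G : {linear completion p -> B} :=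
  HB.pack F (GRing.isLinear.Build R _ B *:%R _ Flin).
exists G; split => //= x.
have := HF x 0; have -> : f 0 = 0 by exact: linear0.
by have -> : completion_in p 0 = 0; [exact: linear0|rewrite !subr0].
Qed.

End CompletionExtension.

Section TensorLift.
Context (R : realType) (X Y : normedModType R).

Definition is_bilinear (B : lmodType R) (m : X -> Y -> B) :=
  (forall y, linear (m^~ y)) /\ (forall x, linear (m x)).

Definition to_bilin_form (m : X -> Y -> R^o) (mb : is_bilinear m) :
    bilin_form X Y :=
  HB.pack m (bilinear_isBilinear.Build R X Y R^o *:%R *:%R m mb).

Lemma tensorP (z : tensor X Y) :
  exists s : seq (X * Y), val z = \sum_(i <- s) elem_tensor i.1 i.2.
Proof. by have := valP z; rewrite inE. Qed.

Lemma sum_elem_tensorE (s : seq (X * Y)) (b : bilin_form X Y) :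
  (\sum_(i <- s) elem_tensor i.1 i.2) b = \sum_(i <- s) b i.1 i.2.
Proof. by rewrite fct_sumE. Qed.

Lemma proj_norm_le (z : tensor X Y) s :
  val z = \sum_(i <- s) elem_tensor i.1 i.2 ->
  proj_norm z <= \sum_(i <- s) `|i.1| * `|i.2|.
Proof.
move=> zs; apply: ge_inf; last by exists s.
by exists 0 => _ [t _ <-]; apply: sumr_ge0 => i _; rewrite mulr_ge0.
Qed.

Lemma proj_norm_ge (z : tensor X Y) c :
  (forall s, val z = \sum_(i <- s) elem_tensor i.1 i.2 ->
    c <= \sum_(i <- s) `|i.1| * `|i.2|) -> c <= proj_norm z.
Proof.
move=> H; apply: lb_le_inf.
  by have [s zs] := tensorP z; exists (\sum_(i <- s) `|i.1| * `|i.2|), s.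
by move=> _ [s zs <-]; exact: H.
Qed.

(** The universal property of the projective tensor product. *)
Lemma tensor_lift (B : completeNormedModType R) (m : X -> Y -> B) (M : R) :
  0 <= M -> is_bilinear m -> (forall x y, `|m x y| <= M * (`|x| * `|y|)) ->
  exists f : {linear proj_tensor X Y -> B},
    (forall v, `|f v| <= M * `|v|) /\
    forall z s, val z = \sum_(i <- s) elem_tensor i.1 i.2 ->
      f (completion_in _ z) = \sum_(i <- s) m i.1 i.2.
Proof.
move=> M0 [ml mr] mM.
have mlE a u v y : m (a *: u + v) y = a *: m u y + m v y by exact: ml.
have mrE a u v x : m x (a *: u + v) = a *: m x u + m x v by exact: mr.
(* two representations of a tensor give the same sum of values of m, since
   they do so after composition with any bounded functional of B *)
have wd s t : \sum_(i <- s) elem_tensor i.1 i.2 = \sum_(i <- t) elem_tensor i.1 i.2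
    :> (bilin_form X Y -> R^o) ->
    \sum_(i <- s) m i.1 i.2 = \sum_(i <- t) m i.1 i.2.
  move=> st; apply/eqP; rewrite -subr_eq0 -normr_eq0.
  set u := _ - _; have [g [gl _ <-]] := norming_functional u.
  pose G : {linear B -> R^o} :=
    HB.pack (g : B -> R^o) (GRing.isLinear.Build R B R^o *:%R _ gl).
  have gb : is_bilinear (fun x y => G (m x y)).
    split=> [y a u1 u2|x a u1 u2].
      change (G (m (a *: u1 + u2) y) = a *: G (m u1 y) + G (m u2 y)).
      by rewrite mlE linearP.
    change (G (m x (a *: u1 + u2)) = a *: G (m x u1) + G (m x u2)).
    by rewrite mrE linearP.
  have Gs (r : seq (X * Y)) : G (\sum_(i <- r) m i.1 i.2) =
      (\sum_(i <- r) elem_tensor i.1 i.2) (to_bilin_form gb).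
    by rewrite sum_elem_tensorE; exact: linear_sum.
  have -> : g u = G (\sum_(i <- s) m i.1 i.2) - G (\sum_(i <- t) m i.1 i.2).
    exact: (linearB G).
  by rewrite !Gs st subrr.
have /choice[rep repP] := tensorP.
pose f z := \sum_(i <- rep z) m i.1 i.2.
have fE z s : val z = \sum_(i <- s) elem_tensor i.1 i.2 ->
    f z = \sum_(i <- s) m i.1 i.2.
  by move=> zs; apply: wd; rewrite -repP.
have fl : linear f.
  move=> a z w.
  rewrite (@fE _ ([seq (a *: i.1, i.2) | i <- rep z] ++ rep w)).
    rewrite big_cat big_map /f scaler_sumr; congr (_ + _); apply: eq_bigr => i _ /=.
    have m0 : m 0 i.2 = 0.
      by have := mlE (-1) 0 0 i.2; rewrite scaler0 addr0 scaleN1r addNr.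
    by have := mlE a i.1 0 i.2; rewrite m0 !addr0.
  have -> : val (a *: z + w) = a *: val z + val w by [].
  rewrite (repP z) (repP w) big_cat big_map scaler_sumr; congr (_ + _).
  apply: eq_bigr => i _.
  by apply/funext => b; rewrite /elem_tensor /= linearZl_LR.
pose g : {linear tensor X Y -> B} := HB.pack f (GRing.isLinear.Build R _ B *:%R _ fl).
have gM z : `|g z| <= M * proj_seminorm X Y z.
  have [M00|Mn] := eqVneq M 0.
    rewrite M00 mul0r /= /f big1 ?normr0// => i _; apply/eqP.
    by rewrite -normr_le0 (le_trans (mM _ _))// M00 mul0r.
  have Mp : 0 < M by rewrite lt_def Mn.
  rewrite -ler_pdivrMl//; apply: proj_norm_ge => s zs.
  rewrite ler_pdivrMl// -[g z]/(f z) (fE _ _ zs).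
  apply: le_trans (ler_norm_sum _ _ _) _; rewrite mulr_sumr.
  by apply: ler_sum => i _; exact: mM.
have [F [Fin FM]] := completion_extension M0 gM.
by exists F; split => // z s zs; rewrite Fin; exact: fE.
Qed.

End TensorLift.

(** * Reflexivity of subspaces of finite powers *)

Section Dual.
Context (R : realType) (V : normedModType R).
Implicit Types (f g : dual_space V).

Lemma mk_dual (f : V -> R) : bounded_functional f ->
  exists g : dual_space V, forall x, g x = f x.
Proof.
move=> [fl [M fM]].
have H : (f : V -> R^o) \in @dual_pred R V.
  by rewrite inE; split => //; exact: (@bounded_linear_cts R V R^o f M fl).
by exists (Dual H).
Qed.

Lemma dualP f a x y : f (a *: x + y) = a * f x + f y.
Proof. by have [fl _] := set_mem (dual_funP f); exact: fl. Qed.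

Lemma dual0 f : f 0 = 0.
Proof. by have := dualP f (-1) 0 0; rewrite scaler0 addr0 mulN1r addNr. Qed.

Lemma dualZ f a x : f (a *: x) = a * f x.
Proof. by have := dualP f a x 0; rewrite dual0 !addr0. Qed.

Lemma dualB f x y : f (x - y) = f x - f y.
Proof. by have := dualP f (-1) y x; rewrite scaleN1r addrC mulN1r [RHS]addrC. Qed.

Lemma dual_bound f x : `|f x| <= `|f| * `|x|.
Proof.
have [fl fc] := set_mem (dual_funP f).
pose g : {linear V -> R^o} :=
  HB.pack (f : V -> R^o) (GRing.isLinear.Build R V R^o *:%R f fl).
have /linear_bounded_continuous/bounded_funP/(_ 1)[M hM] : continuous g by [].
have f1 y : `|y| <= 1 -> `|f y| <= `|f|.
  move=> y1; apply: ub_le_sup; last by exists y.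
  by exists M => _ [z [_ z1] <-]; exact: hM.
have [->|x0] := eqVneq x 0; first by rewrite dual0 !normr0 mulr0.
have xn : `|x| != 0 by rewrite normr_eq0.
have := f1 (`|x|^-1 *: x); rewrite normrZ normfV normr_id mulVf// => /(_ (lexx _)).
by rewrite dualZ normrM normfV normr_id mulrC ler_pdivrMr// lt_def xn/=.
Qed.

Lemma dual_norm_le f M : 0 <= M -> (forall x, `|f x| <= M * `|x|) -> `|f| <= M.
Proof.
move=> M0 fM; have /andP[] // : 0 <= opnorm setT (f : V -> R^o) <= M.
apply: opnorm_bounds => // x _ x1; apply: le_trans (fM x) _.
by rewrite ler_piMr.
Qed.

Lemma dual_eq f g : (forall x, f x = g x) -> f = g.
Proof. by move=> fg; apply: val_inj; apply/funext. Qed.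

End Dual.

(** The distance of a point to the range of L, measured by N, is a seminorm
    below N that vanishes on that range. *)
Section DistanceToRange.
Context (R : realType) (P W : lmodType R) (N : seminorm P) (L : {linear W -> P}).

Definition range_dists (x : P) := [set N (x - L w) | w in [set: W]].

Definition range_dist (x : P) := inf (range_dists x).

Lemma has_inf_range_dists x : has_inf (range_dists x).
Proof.
split; first by exists (N (x - L 0)), 0.
by exists 0 => _ [w _ <-]; exact: seminorm_ge0.
Qed.

Lemma range_dist_le x w : range_dist x <= N (x - L w).
Proof. by apply: ge_inf; [case: (has_inf_range_dists x)|exists w]. Qed.

Lemma range_dist_lt x e : 0 < e -> exists w, N (x - L w) < range_dist x + e.
Proof.
move=> e0; have [_ [w _ <-] hw] := inf_adherent e0 (has_inf_range_dists x).
by exists w.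
Qed.

Lemma range_distD x y : range_dist (x + y) <= range_dist x + range_dist y.
Proof.
apply/ler_addgt0Pr => e e0.
have [w hw] := range_dist_lt x (divr_gt0 e0 (ltr0n _ 2)).
have [v hv] := range_dist_lt y (divr_gt0 e0 (ltr0n _ 2)).
have := range_dist_le (x + y) (w + v); rewrite linearD opprD addrACA.
have := seminormD N (x - L w) (y - L v); lra.
Qed.

Lemma range_distZ a x : range_dist (a *: x) = `|a| * range_dist x.
Proof.
have le b y : range_dist (b *: y) <= `|b| * range_dist y.
  apply/ler_addgt0Pr => e e0.
  have b1 : 0 < `|b| + 1 by rewrite ltr_wpDl.
  have [w hw] := range_dist_lt y (divr_gt0 e0 b1).
  apply: le_trans (range_dist_le _ (b *: w)) _.
  rewrite linearZ/= -scalerBr seminormZ.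
  have := ler_wpM2l (normr_ge0 b) (ltW hw); rewrite mulrDr => /le_trans; apply.
  rewrite lerD2l mulrA ler_pdivrMr// mulrC ler_wpM2l ?(ltW e0)//; lra.
apply/eqP; rewrite eq_le le/=.
have [->|a0] := eqVneq a 0.
  rewrite normr0 mul0r; apply: lb_le_inf; first by case: (has_inf_range_dists (0 *: x)).
  by move=> _ [w _ <-]; exact: seminorm_ge0.
rewrite -ler_pdivlMl ?normr_gt0// -normfV.
by rewrite -{1}[x]scale1r -(mulVf a0) -scalerA le.
Qed.

Definition range_dist_seminorm := Seminorm range_distD range_distZ.

(** A Hahn-Banach functional that norms x for the distance to the range of L
    vanishes on that range; by hypothesis it vanishes at x, so the distance of x
    to the range is 0. *)
Lemma in_closure_range x :
  (forall G : {linear P -> R^o}, (forall y, `|G y| <= N y) ->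
    (forall w, G (L w) = 0) -> G x = 0) ->
  forall e, 0 < e -> exists w, N (x - L w) < e.
Proof.
move=> H e e0; have [G [GN Gx]] := hahn_banach range_dist_seminorm x.
suff D0 : range_dist x = 0.
  by have [w] := range_dist_lt x e0; rewrite D0 add0r; exists w.
rewrite -[LHS]/(range_dist_seminorm x) -Gx; apply: H.
  move=> y; apply: le_trans (GN y) _; have := range_dist_le y 0.
  by rewrite linear0 subr0.
move=> w; apply/eqP; rewrite -normr_le0; apply: le_trans (GN _) _.
by have := range_dist_le (L w) w; rewrite subrr seminorm0.
Qed.

End DistanceToRange.

(** The J_k embed W isomorphically into the n-th power of W0. *)
Section ReflexiveEmbedding.
Context (R : realType) (W : completeNormedModType R) (W0 : normedModType R).
Context (n : nat) (J : 'I_n -> {linear W -> W0}) (M C : R).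
Hypothesis M0 : 0 <= M.
Hypothesis JM : forall k w, `|J k w| <= M * `|w|.
Hypothesis JC : forall w, `|w| <= C * \sum_k `|J k w|.
Hypothesis C0 : 0 <= C.

Lemma pullback_dual k (g : dual_space W0) :
  exists f : dual_space W, forall w, f w = g (J k w).
Proof.
apply: mk_dual; split.
  by move=> a x y; rewrite linearP/= dualP.
exists (`|g| * M) => w; apply: le_trans (dual_bound _ _) _.
by rewrite -mulrA ler_wpM2l.
Qed.

(* the real factor carries the value of one functional f of W, so that the
   closure argument controls the point and the value of f at it together *)
Let N (x : ('I_n -> W0) * R^o) : R := \sum_k `|x.1 k| + `|x.2|.

Let ND x y : N (x + y) <= N x + N y.
Proof.
rewrite /N addrACA -big_split lerD ?ler_normD// ler_sum// => k _.
exact: ler_normD.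
Qed.

Let NZ a x : N (a *: x) = `|a| * N x.
Proof.
rewrite /N mulrDr mulr_sumr; congr (_ + _); last exact: normrM.
by apply: eq_bigr => k _; exact: normrZ.
Qed.

Let Ns := Seminorm ND NZ.

Let single k (u : W0) : 'I_n -> W0 := fun j => if j == k then u else 0.

Let decomp (x : ('I_n -> W0) * R^o) :
  x = \sum_k (single k (x.1 k), 0) + x.2 *: (0, 1).
Proof.
case: x => h s /=.
have -> : \sum_k (single k (h k), 0 : R^o) = (h, 0).
  apply: injective_projections.
    rewrite (raddf_sum fst)/=; apply/funext => j.
    rewrite fct_sumE (bigD1 j)//= /single eqxx big1 ?addr0// => k kj.
    by rewrite eq_sym (negbTE kj).
  by rewrite (raddf_sum snd)/= big1.
apply: injective_projections => /=; first by rewrite scaler0 addr0.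
by rewrite add0r -[s *: 1]/(s * 1) mulr1.
Qed.

(** A functional of W0^n * R vanishing on all points (J w, f w) is given by
    functionals g_k of W0 and a scalar s with sum_k g_k \o J_k + s f = 0 in the
    dual of W; applying Phi shows that it vanishes at (w0, Phi f) as well.  Hence
    (w0, Phi f) is in the closure of these points. *)
Lemma bidual_approx (Phi : dual_space (dual_space W)) (w0 : 'I_n -> W0)
    (f : dual_space W) :
  (forall k (g : dual_space W0) (h : dual_space W),
    (forall w, h w = g (J k w)) -> Phi h = g (w0 k)) ->
  forall e, 0 < e -> exists w, \sum_k `|w0 k - J k w| + `|Phi f - f w| < e.
Proof.
move=> HPhi.
have Llin : linear (fun w => ((fun k => J k w), f w : R^o)).
  move=> a x y; apply: injective_projections => /=; last exact: dualP.
  by apply/funext => k; rewrite linearP.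
pose L : {linear W -> (('I_n -> W0) * R^o)%type} :=
  HB.pack (fun w => ((fun k => J k w), f w : R^o))
    (GRing.isLinear.Build R _ _ *:%R _ Llin).
suff H e : 0 < e -> exists w, Ns ((w0, Phi f : R^o) - L w) < e by exact: H.
apply: in_closure_range => G GN GL.
have /choice[g gP] : forall k, exists g : dual_space W0,
    forall u, g u = G (single k u, 0).
  move=> k; apply: mk_dual; split.
    move=> a x y; rewrite -linearP/=; congr (G _); apply: injective_projections => /=.
      apply/funext => j; rewrite /single/= -[RHS]/(_ *: _ + _).
      by case: ifP => // _; rewrite scaler0 addr0.
    by rewrite scaler0 addr0.
  exists 1 => u; rewrite mul1r; apply: le_trans (GN _) _.
  rewrite /= /N /= normr0 addr0 (bigD1 k)//= /single eqxx big1 ?addr0// => j jk.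
  by rewrite (negbTE jk) normr0.
have GE x : G x = \sum_k g k (x.1 k) + x.2 * G (0, 1).
  rewrite [in LHS](decomp x) linearD linear_sum linearZ/=; congr (_ + _).
  by apply: eq_bigr => k _; rewrite gP.
have /choice[h hP] : forall k, exists h : dual_space W, forall w, h w = g k (J k w).
  by move=> k; exact: pullback_dual.
pose s := G (0, 1).
have PhiD a x y : Phi (a *: x + y) = a * Phi x + Phi y by exact: dualP.
have Z : \sum_k h k + s *: f = 0.
  apply: dual_eq => w.
  have -> : (\sum_k h k + s *: f) w = \sum_k h k w + s * f w.
    have E (r : seq 'I_n) : (\sum_(k <- r) h k + s *: f) w =
        \sum_(k <- r) h k w + s * f w.
      elim: r => [|k r IH]; first by rewrite !big_nil !add0r.
      by rewrite !big_cons -!addrA -IH.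
    exact: E.
  have -> : (0 : dual_space W) w = 0 by [].
  rewrite -[RHS](GL w) GE -/s [f w * s]mulrC; congr (_ + _).
  by apply: eq_bigr => k _; rewrite hP.
have E (r : seq 'I_n) : \sum_(k <- r) g k (w0 k) + s * Phi f =
    Phi (\sum_(k <- r) h k + s *: f).
  elim: r => [|k r IH]; first by rewrite !big_nil !add0r dualZ.
  rewrite !big_cons -!addrA IH -[h k + _]/(h k + (_ + _)).
  have := PhiD 1 (h k) (\sum_(j <- r) h j + s *: f); rewrite scale1r mul1r => ->.
  by rewrite (HPhi k (g k) _ (hP k)).
by rewrite GE/= -/s [Phi f * s]mulrC E Z dual0.
Qed.

(** Reflexivity of W0 represents each g |-> Phi (g \o J_k) by a point w0_k.  By
    [bidual_approx] and completeness of W there is w with J_k w = w0_k for all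
    k; since the J_k determine w, the approximating points for every f converge
    to this same w, and Phi f = f w. *)
Theorem reflexive_of_embedding : is_reflexive W0 -> is_reflexive W.
Proof.
move=> refl0 Phi; have M0' := M0; have C0' := C0.
have /choice[w0 w0P] : forall k, exists w0,
    forall (g : dual_space W0) (h : dual_space W),
    (forall w, h w = g (J k w)) -> Phi h = g w0.
  move=> k; have /choice[pull pullP] := pullback_dual k.
  have [Phik PhikE] : exists Phik : dual_space (dual_space W0),
      forall g, Phik g = Phi (pull g).
    apply: mk_dual; split.
      move=> a x y; change (Phi (pull (a *: x + y)) = a * Phi (pull x) + Phi (pull y)).
      rewrite -dualP; congr (Phi _); apply: dual_eq => w.
      by rewrite pullP -[RHS]/(a * pull x w + pull y w) !pullP.
    exists (`|Phi| * M) => g; apply: le_trans (dual_bound _ _) _.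
    rewrite -mulrA ler_wpM2l//; apply: dual_norm_le; first by rewrite mulr_ge0.
    move=> w; rewrite pullP; apply: le_trans (dual_bound _ _) _.
    by rewrite [M * _]mulrC -mulrA ler_wpM2l.
  have [x0 x0P] := refl0 Phik; exists x0 => g h hg.
  by rewrite -x0P PhikE; congr (Phi _); apply: dual_eq => w; rewrite hg pullP.
have approx f e : 0 < e -> exists w, \sum_k `|w0 k - J k w| + `|Phi f - f w| < e.
  exact: (@bidual_approx Phi w0 f w0P).
have near_close v w a b : \sum_k `|w0 k - J k v| <= a ->
    \sum_k `|w0 k - J k w| <= b ->
    `|v - w| <= C * (a + b).
  move=> ha hb; apply: le_trans (JC _) _; apply: ler_wpM2l => //.
  apply: le_trans (lerD ha hb); rewrite -big_split; apply: ler_sum => k _ /=.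
  rewrite linearB; have := ler_distD (w0 k) (J k v) (J k w).
  by rewrite [`|J k v - w0 k|]distrC.
have [d [d0 small]] : exists d : nat -> R, (forall n, 0 < d n) /\
    forall e, 0 < e -> \forall n \near \oo, d n < e.
  exists (fun n => n.+1%:R^-1); split=> [m|e e0]; first by rewrite invr_gt0.
  by have [N' _ HN] := near_infty_natSinv_lt (PosNum e0); exists N'.
have /choice[v vd] : forall m, exists v, \sum_k `|w0 k - J k v| <= d m.
  move=> m; have [v hv] := approx 0 _ (d0 m); exists v.
  by apply: le_trans (ltW hv); rewrite lerDl.
have sC e : 0 < e -> \forall m \near \oo, C * d m < e.
  move=> e0; have C1 : 0 < C + 1 by lra.
  apply: filterS (small _ (divr_gt0 e0 C1)) => m; rewrite ltr_pdivlMr// => h.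
  by apply: le_lt_trans h; have := d0 m; nra.
have /cvg_ex[w vw] : cvg (v @ \oo).
  apply/cauchy_cvgP/cauchy_exP => e e0.
  have [N' _ HN] := sC _ (divr_gt0 e0 (ltr0n _ 2)).
  exists (v N'); exists N' => // m /= Nm.
  rewrite -ball_normE /=; apply: le_lt_trans (near_close _ _ _ _ (vd N') (vd m)) _.
  have := HN m Nm; have := HN N' (leqnn N'); rewrite /= mulrDr; lra.
have wE k : w0 k = J k w.
  apply/eqP; rewrite -subr_eq0 -normr_le0; apply/ler_addgt0Pr => e e0; rewrite add0r.
  have M1 : 0 < M + 1 by lra.
  have [N1 _ H1] := small _ (divr_gt0 e0 (ltr0n _ 2)).
  move/cvgrPdist_lt: vw => /(_ _ (divr_gt0 (divr_gt0 e0 (ltr0n _ 2)) M1))[N2 _ H2].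
  pose m := maxn N1 N2.
  have := H1 m (leq_maxl _ _); have := H2 m (leq_maxr _ _) => /=.
  rewrite ltr_pdivlMr// => h2 h1.
  have h3 : `|w0 k - J k (v m)| <= d m.
    by apply: le_trans (vd m); rewrite (bigD1 k)//= lerDl sumr_ge0.
  have h4 : `|J k (v m) - J k w| <= M * `|w - v m|.
    by rewrite -linearB distrC; apply: le_trans (JM _ _) _.
  have := ler_distD (J k (v m)) (w0 k) (J k w).
  have := normr_ge0 (w - v m); nra.
exists w => f; apply/eqP; rewrite -subr_eq0 -normr_le0.
apply/ler_addgt0Pr => e e0; rewrite add0r.
have c1 : 0 < 1 + `|f| * C by rewrite ltr_pwDl// mulr_ge0.
have [u hu] := approx f _ (divr_gt0 e0 c1).
move: hu; set t := e / _ => hu.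
have te : t * (1 + `|f| * C) = e by rewrite divfK// gt_eqF.
have hw0 : \sum_k `|w0 k - J k w| <= 0 by rewrite big1// => k _; rewrite wE subrr normr0.
have hu1 : \sum_k `|w0 k - J k u| <= t.
  by apply: le_trans (ltW hu); rewrite lerDl.
have hu2 : `|Phi f - f u| <= t - 0 .
  by rewrite subr0; apply: le_trans (ltW hu); rewrite lerDr sumr_ge0.
have uw := near_close _ _ _ _ hu1 hw0.
have fuw : `|f u - f w| <= `|f| * (C * t).
  rewrite -dualB; apply: le_trans (dual_bound _ _) _; rewrite ler_wpM2l//.
  by rewrite addr0 in uw.
have := ler_distD (f u) (Phi f) (f w); rewrite -te mulrDr mulr1.
rewrite [t * (_ * _)]mulrC -mulrA; lra.
Qed.

End ReflexiveEmbedding.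

(** * Superreflexivity of subspaces of finite powers *)

Section FindimSubspaces.
Context (R : realType).

Lemma findim_add (V : lmodType R) (E F : set V) :
  findim_subspace E -> findim_subspace F ->
  exists G, [/\ findim_subspace G, E `<=` G & F `<=` G].
Proof.
move=> [n [b ->]] [m [c ->]].
pose d (i : 'I_(n + m)) := 
  match fintype.split i with inl j => b j | inr j => c j end.
exists [set \sum_i a i *: d i | a in [set: 'I_(n + m) -> R]]; split.
- by exists (n + m)%N, d.
- move=> _ [a _ <-].
  exists (fun i => match fintype.split i with inl j => a j | inr _ => 0 end) => //.
  rewrite big_split_ord /= [X in _ + X]big1 ?addr0.
    by apply: eq_bigr => i _; rewrite /d; case: split_ordP => j;
      [move/lshift_inj=> ->|move/eqP; rewrite eq_lrshift].
  by move=> i _; case: split_ordP => j;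
    [move/eqP; rewrite eq_rlshift|rewrite scale0r].
- move=> _ [a _ <-].
  exists (fun i => match fintype.split i with inl _ => 0 | inr j => a j end) => //.
  rewrite big_split_ord /= [X in X + _]big1 ?add0r.
    by apply: eq_bigr => i _; rewrite /d; case: split_ordP => j;
      [move/eqP; rewrite eq_rlshift|move/rshift_inj=> ->].
  by move=> i _; case: split_ordP => j;
    [rewrite scale0r|move/eqP; rewrite eq_lrshift].
Qed.

Lemma findim_span2 (V : lmodType R) (x y : V) :
  exists E, [/\ findim_subspace E, E x & E y].
Proof.
pose b (i : 'I_2) := if i == 0 then x else y.
exists [set \sum_i a i *: b i | a in [set: 'I_2 -> R]]; split.
- by exists 2%N, b.
- exists (fun i => (i == 0)%:R) => //.
  by rewrite !big_ord_recl big_ord0 /b/= scale1r scale0r !addr0.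
- exists (fun i => (i != 0)%:R) => //.
  by rewrite !big_ord_recl big_ord0 /b/= scale1r scale0r add0r addr0.
Qed.

Lemma findim_linear_closed (V : lmodType R) (E : set V) a x y :
  findim_subspace E -> E x -> E y -> E (a *: x + y).
Proof.
move=> /findim_basis[n [b [-> _]]] [u _ <-] [v _ <-].
by exists (a *: u + v) => //; rewrite linearP.
Qed.

Lemma findim0 (V : lmodType R) (E : set V) : findim_subspace E -> E 0.
Proof. by move=> /findim_basis[n [b [-> _]]]; exists 0 => //; rewrite linear0. Qed.

Lemma linear_on_bounded (V W : normedModType R) (E : set V) (f : V -> W) :
  findim_subspace E -> linear_on E f ->
  exists2 M, 0 <= M & forall x, E x -> `|f x| <= M * `|x|.
Proof.
move=> Efin fl; have [n [b [EE bfree]]] := findim_basis Efin.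
have [c c0 cb] := lcomb_lower_bound bfree.
have Eb a : E (lcomb b a) by rewrite EE; exists a.
have gl : linear (f \o lcomb b).
  by move=> t u v; rewrite /= linearP/= fl.
pose g : {linear 'rV[R]_n -> W} :=
  HB.pack (f \o lcomb b) (GRing.isLinear.Build R _ W *:%R _ gl).
pose S := \sum_i `|g (delta_mx 0 i)|.
have S0 : 0 <= S by apply: sumr_ge0.
exists (S / c); first by rewrite divr_ge0// ltW.
move=> x; rewrite {1}EE => -[a _ <-].
have -> : f (lcomb b a) = lcomb (g \o (fun i => delta_mx 0 i)) a.
  rewrite -linear_lcomb -[LHS]/(g a); congr (g _).
  by rewrite [LHS]row_sum_delta.
apply: le_trans (normr_lcomb _ _) _; rewrite mulrC -/S -mulrA ler_wpM2l//.
by rewrite mulrC ler_pdivlMr// mulrC.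
Qed.

Lemma linear_on_opnorm (V W : normedModType R) (E : set V) (f : V -> W) x :
  findim_subspace E -> linear_on E f -> E x -> `|f x| <= opnorm E f * `|x|.
Proof.
move=> Efin fl Ex; have [M M0 fM] := linear_on_bounded Efin fl.
have f0 : f 0 = 0.
  have E0 := findim0 Efin; have := fl (-1) _ _ E0 E0.
  by rewrite scaler0 addr0 scaleN1r addNr.
have fZ a y : E y -> f (a *: y) = a *: f y.
  move=> Ey; have := fl a _ _ Ey (findim0 Efin).
  by rewrite f0 !addr0.
have [->|x0] := eqVneq x 0; first by rewrite f0 !normr0 mulr0.
have xn : 0 < `|x| by rewrite normr_gt0.
have : `|f (`|x|^-1 *: x)| <= opnorm E f.
  apply: ub_le_sup.
    exists M => _ [y [Ey y1] <-]; apply: le_trans (fM _ Ey) _.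
    by rewrite ler_piMr.
  exists (`|x|^-1 *: x) => //; split.
    by have := findim_linear_closed (`|x|^-1) Efin Ex (findim0 Efin); rewrite addr0.
  by rewrite /= normrZ normfV normr_id mulVf// gt_eqF.
by rewrite fZ// normrZ normfV normr_id mulrC ler_pdivrMr.
Qed.

End FindimSubspaces.

(** T is rescaled by the norm of its inverse. *)
Lemma finitely_representable_almost_isometry (R : realType)
    (W V : normedModType R) (E : set W) e :
  finitely_representable W V -> findim_subspace E -> 0 < e ->
  exists2 T : W -> V, linear_on E T &
    forall x, E x -> `|x| <= `|T x| <= (1 + e) * `|x|.
Proof.
move=> WV Efin e0.
have [F [T [S [Ffin Tl [TF Tinj Tsurj] TS Te]]]] := WV E e Efin e0.
have EK x : E x -> S (T x) = x by move=> Ex; apply: TS; rewrite inE.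
have Sl : linear_on F S.
  move=> a _ _ /Tsurj[x Ex <-] /Tsurj[y Ey <-].
  by rewrite -Tl// !EK//; exact: findim_linear_closed.
pose s := opnorm F S.
have sx x : E x -> `|x| <= s * `|T x|.
  move=> Ex; rewrite -{1}(EK x Ex); apply: linear_on_opnorm => //.
  exact: TF.
have tx x : E x -> `|T x| <= opnorm E T * `|x| by exact: linear_on_opnorm.
have s0 : 0 <= s.
  have [M M0 SM] := linear_on_bounded Ffin Sl.
  have /andP[] // : 0 <= opnorm F S <= M.
  apply: opnorm_bounds; first exact: findim0.
  by move=> y Fy y1; apply: le_trans (SM y Fy) _; rewrite ler_piMr.
exists (fun x => s *: T x).
  by move=> a x y Ex Ey; rewrite Tl// scalerDr !scalerA mulrC.
move=> x Ex; rewrite normrZ ger0_norm// sx//=.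
apply: le_trans (ler_wpM2l s0 (tx x Ex)) _; rewrite mulrA ler_wpM2r//.
by rewrite mulrC.
Qed.

Section SuperreflexiveEmbedding.
Context (R : realType) (V Y : completeNormedModType R).
Context (n : nat) (q : 'I_n -> {linear V -> Y}) (M C : R).
Hypothesis M0 : 0 <= M.
Hypothesis qM : forall k v, `|q k v| <= M * `|v|.
Hypothesis C0 : 0 <= C.
Hypothesis qC : forall v, `|v| <= C * \sum_k `|q k v|.

(** For W finitely representable in V, the seminorm on W^n is the limit of
    |sum_k q_k (T z_k)| along an ultrafilter of maps T : W -> V containing, for
    each finite-dimensional E, the set of those T that are linear and expand
    norms by a factor between 1 and 2 on E.  A seminorm on the power W^n, rather
    than n seminorms on W, puts the images of all q_k into one space W0. *)
Theorem superreflexive_of_embedding : superreflexive Y -> superreflexive V.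
Proof.
move=> srY W WV.
pose good (E : set W) := [set T : W -> V | linear_on E T /\
  forall x, E x -> `|x| <= `|T x| <= 2 * `|x|].
pose F := filter_from (@findim_subspace R W) good.
have FF : ProperFilter F.
  apply: filter_from_proper; last first.
    move=> E Efin.
    have [T Tl Tx] := finitely_representable_almost_isometry WV Efin ltr01.
    by exists T; split.
  apply: filter_from_filter.
    by have [E [Efin _ _]] := findim_span2 (0 : W) 0; exists E.
  move=> E1 E2 E1f E2f; have [G [Gf G1 G2]] := findim_add E1f E2f.
  exists G => // T [Tl Tx]; split; split.
  - by move=> a x y /G1 Gx /G1 Gy; exact: Tl.
  - by move=> x /G1; exact: Tx.
  - by move=> a x y /G2 Gx /G2 Gy; exact: Tl.
  - by move=> x /G2; exact: Tx.
have [U [UU FU]] := ultraFilterLemma FF.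
have Tlin (a : R) (x y : W) :
    \forall T \near U, (T : W -> V) (a *: x + y) = a *: T x + T y.
  have [E [Efin Ex Ey]] := findim_span2 x y.
  by apply: FU; exists E => // T [Tl _]; exact: Tl.
have Tnorm (x : W) : \forall T \near U, `|x| <= `|(T : W -> V) x| <= 2 * `|x|.
  have [E [Efin Ex _]] := findim_span2 x x.
  by apply: FU; exists E => // T [_ Tx]; exact: Tx.
pose TT (T : W -> V) (z : 'I_n -> W) : Y := \sum_k q k (T (z k)).
have TTlin a x y : \forall T \near U, TT T (a *: x + y) = a *: TT T x + TT T y.
  have : \forall T \near U, forall k, T (a *: x k + y k) = a *: T (x k) + T (y k).
    by apply: filter_forall => k.
  apply: filterS => T H; rewrite /TT scaler_sumr -big_split; apply: eq_bigr => k _.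
  by rewrite /= -linearP -H.
have [p pT] : exists p : seminorm ('I_n -> W),
    forall z, `|TT T z| @[T --> U] --> p z.
  apply: (limit_seminorm TTlin UU) => z.
  exists (\sum_k M * (2 * `|z k|)).
  have : \forall T \near U, forall k, `|(T : W -> V) (z k)| <= 2 * `|z k|.
    by apply: filter_forall => k; apply: filterS (Tnorm (z k)) => T /andP[].
  apply: filterS => T H; apply: le_trans (ler_norm_sum _ _ _) _.
  apply: ler_sum => k _; apply: le_trans (qM _ _) _; exact: ler_wpM2l.
have refl0 : is_reflexive (completion p).
  apply: srY; exact: (completion_finitely_representable TTlin _ pT).
pose single (k : 'I_n) (w : W) : 'I_n -> W := fun j => if j == k then w else 0.
have Jl k : linear (completion_in p \o single k).
  move=> a x y; rewrite /= -linearP; congr completion_in.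
  apply/funext => j; rewrite /single.
  rewrite -[RHS]/(a *: (if j == k then x else 0) + (if j == k then y else 0)).
  by case: ifP => // _; rewrite scaler0 addr0.
pose J k : {linear W -> completion p} :=
  HB.pack (completion_in p \o single k) (GRing.isLinear.Build R W _ *:%R _ (Jl k)).
have T0 : \forall T \near U, (T : W -> V) 0 = 0.
  apply: filterS (Tlin (-1) 0 0) => T; rewrite scaler0 addr0 => ->.
  by rewrite scaleN1r addNr.
have JT k w : `|q k (T w)| @[T --> U] --> `|J k w|.
  rewrite [`|J k w|]completion_in_norm.
  apply: cvg_trans (pT (single k w)); apply: near_eq_cvg.
  apply: filterS T0 => T T0; rewrite /TT (bigD1 k)//= /single eqxx.
  rewrite big1 ?addr0// => j jk.
  by rewrite (negbTE jk) T0 linear0.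
apply: (@reflexive_of_embedding R W (completion p) n J (M * 2) C) => //.
- by rewrite mulr_ge0.
- move=> k w; apply: (cvgr_to_le (JT k w)).
  apply: filterS (Tnorm w) => T /andP[_ h]; apply: le_trans (qM _ _) _.
  by rewrite -mulrA ler_wpM2l.
- move=> w.
  have sumT : (fun T : W -> V => \sum_k `|q k (T w)|) @ U --> \sum_k `|J k w|.
    by apply: cvg_sum_ord => k; exact: JT.
  have CsumT :
      (fun T : W -> V => C * \sum_k `|q k (T w)|) @ U --> C * \sum_k `|J k w|.
    exact: cvgMr sumT.
  apply: (cvgr_to_ge CsumT).
  apply: filterS (Tnorm w) => T /andP[h _]; exact: le_trans h (qC _).
Qed.

End SuperreflexiveEmbedding.

(** * Tensor products with a finite-dimensional factor *)

(** The maps m_k are the coordinates of a tensor and e_k u is the elementary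
    tensor with k-th coordinate u, so that x (x) y is the sum over k of the
    e_k (m_k x y).  The case of a finite-dimensional left factor takes
    e_k u = (b_k, u), that of a right factor e_k u = (u, b_k). *)
Lemma superreflexive_proj_tensor (R : realType) (X Y : normedModType R)
    (B : completeNormedModType R) n
    (m : 'I_n -> X -> Y -> B) (e : 'I_n -> B -> X * Y) (M C : R) :
  0 <= M -> (forall k, is_bilinear (m k)) ->
  (forall k x y, `|m k x y| <= M * (`|x| * `|y|)) ->
  0 <= C -> (forall k u, `|(e k u).1| * `|(e k u).2| <= C * `|u|) ->
  (forall k (b : bilin_form X Y), linear (fun u => b (e k u).1 (e k u).2)) ->
  (forall (b : bilin_form X Y) x y,
    b x y = \sum_k b (e k (m k x y)).1 (e k (m k x y)).2) ->
  superreflexive B -> superreflexive (proj_tensor X Y).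
Proof.
move=> M0 mb mM C0 eC el eE.
have /choice[f fP] := fun k => tensor_lift M0 (mb k) (mM k).
apply: (@superreflexive_of_embedding R _ B n f M C) => //.
  by move=> k; have [] := fP k.
have f_in z : `|completion_in (proj_seminorm X Y) z| <=
    C * \sum_k `|f k (completion_in _ z)|.
  rewrite completion_in_norm; have [s zs] := tensorP z.
  set u := fun k => f k (completion_in (proj_seminorm X Y) z).
  have uE k : u k = \sum_(i <- s) m k i.1 i.2 by have [_ h] := fP k; exact: h.
  apply: (@le_trans _ _
    (\sum_(i <- [seq e k (u k) | k <- enum 'I_n]) `|i.1| * `|i.2|)).
    apply: proj_norm_le; rewrite zs; apply/funext => b; rewrite !sum_elem_tensorE.
    rewrite big_map big_enum /=; under eq_bigr do rewrite eE.
    rewrite exchange_big /=; apply: eq_bigr => k _; rewrite uE.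
    pose h : {linear B -> R^o} := HB.pack (fun u => b (e k u).1 (e k u).2 : R^o)
      (GRing.isLinear.Build R B R^o *:%R _ (el k b)).
    by rewrite -[RHS]/(h _) linear_sum.
  by rewrite big_map big_enum /= mulr_sumr; apply: ler_sum => k _.
(* the bound extends from the algebraic tensor product by density *)
move=> v; apply/ler_addgt0Pr => t t0.
have K0 : 0 < 1 + C * n%:R * M by rewrite ltr_pwDl// !mulr_ge0.
have [z vz] := completion_in_dense v (divr_gt0 t0 K0).
set d := `|v - _| in vz.
have : `|v| <= d + C * \sum_k (`|f k v| + M * d).
  have := ler_normD (v - completion_in _ z) (completion_in _ z); rewrite subrK.
  move=> /le_trans; apply; rewrite lerD2l; apply: le_trans (f_in z) _.
  apply: ler_wpM2l => //; apply: ler_sum => k _.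
  have [fM _] := fP k; have := fM (v - completion_in _ z).
  rewrite linearB distrC => h.
  have := ler_normD (f k (completion_in _ z) - f k v) (f k v); rewrite subrK.
  by rewrite -/d in h; lra.
rewrite big_split sumr_const card_ord -[_ *+ n]mulr_natr mulrDr /=.
move: vz; rewrite ltr_pdivlMr// => vz h; apply: le_trans h _.
by rewrite addrCA lerD2l; lra.
Qed.

Lemma findim_coordinates (R : realType) (X : normedModType R) :
  finite_dimensional X -> exists n (b : 'I_n -> X) (a : X -> 'rV[R]_n) (M : R),
  [/\ linear a, forall x, x = lcomb b (a x), 0 <= M & forall x, `|a x| <= M * `|x|].
Proof.
move=> /findim_basis[n [b [EE bfree]]].
have [c c0 cb] := lcomb_lower_bound bfree.
have /choice[a aP] : forall x, exists a, x = lcomb b a.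
  by move=> x; have : [set: X] x by []; rewrite EE => -[a _ <-]; exists a.
exists n, b, a, c^-1; split => //.
- move=> t x y; apply/eqP; rewrite -subr_eq0; apply/eqP/bfree.
  by rewrite linearB linearP/= -!aP subrr.
- by rewrite invr_ge0 ltW.
- by move=> x; rewrite mulrC ler_pdivlMr// mulrC {2}(aP x).
Qed.

Theorem superreflexive_proj_tensor_l (R : realType) (X : normedModType R)
    (Y : completeNormedModType R) :
  finite_dimensional X -> superreflexive Y -> superreflexive (proj_tensor X Y).
Proof.
move=> /findim_coordinates[n [b [a [M [al ab M0 aM]]]]].
apply: (superreflexive_proj_tensor (m := fun k x y => a x 0 k *: y)
  (e := fun k u => (b k, u)) (M := M) (C := \sum_k `|b k|)) => //=.
- move=> k; split=> [y t u v|x t u v].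
    change (a (t *: u + v) 0 k *: y = t *: (a u 0 k *: y) + a v 0 k *: y).
    by rewrite al !mxE scalerDl scalerA.
  change (a x 0 k *: (t *: u + v) = t *: (a x 0 k *: u) + a x 0 k *: v).
  by rewrite scalerDr !scalerA mulrC.
- move=> k x y; rewrite normrZ mulrA ler_wpM2r//.
  exact: le_trans (coord_le_norm _ _) (aM x).
- by apply: sumr_ge0.
- by move=> k u; rewrite ler_wpM2r// (bigD1 k)//= lerDl sumr_ge0.
- by move=> k f t u v; rewrite linearPr.
- move=> f x y; rewrite {1}(ab x) /lcomb linear_sumlz; apply: eq_bigr => k _.
  by rewrite linearZl_LR linearZr_LR.
Qed.

Theorem superreflexive_proj_tensor_r (R : realType) (X : completeNormedModType R)
    (Y : normedModType R) :
  finite_dimensional Y -> superreflexive X -> superreflexive (proj_tensor X Y).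
Proof.
move=> /findim_coordinates[n [b [a [M [al ab M0 aM]]]]].
apply: (superreflexive_proj_tensor (m := fun k x y => a y 0 k *: x)
  (e := fun k u => (u, b k)) (M := M) (C := \sum_k `|b k|)) => //=.
- move=> k; split=> [y t u v|x t u v].
    change (a y 0 k *: (t *: u + v) = t *: (a y 0 k *: u) + a y 0 k *: v).
    by rewrite scalerDr !scalerA mulrC.
  change (a (t *: u + v) 0 k *: x = t *: (a u 0 k *: x) + a v 0 k *: x).
  by rewrite al !mxE scalerDl scalerA.
- move=> k x y; rewrite normrZ [`|x| * _]mulrC mulrA ler_wpM2r//.
  exact: le_trans (coord_le_norm _ _) (aM y).
- by apply: sumr_ge0.
- by move=> k u; rewrite mulrC ler_wpM2r// (bigD1 k)//= lerDl sumr_ge0.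
- by move=> k f t u v; rewrite linearPl.
- move=> f x y; rewrite {1}(ab y) /lcomb linear_sumr; apply: eq_bigr => k _.
  by rewrite linearZl_LR linearZr_LR.
Qed.

(** * Copies of l1 in projective tensor products *)

Section Bessel.
Context (R : realType) (X : normedModType R) (q : X -> X -> R).
Context (N : nat) (eps : R) (x : nat -> X).
Hypothesis qc : contractive q.
Hypothesis x1 : forall i, (i < N)%N -> `|x i| <= 1.
Hypothesis xe : forall i j, (i < N)%N -> (j < i)%N -> `|q (x i) (x j)| <= eps.
Hypothesis eN : eps * N%:R <= 1.
Hypothesis e0 : 0 <= eps.

Lemma off_diagonal i j : (i < N)%N -> (j < N)%N -> i != j ->
  `|q (x i) (x j)| <= eps.
Proof.
move=> iN jN; rewrite neq_ltn => /orP[ij|ji]; last exact: xe.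
by rewrite (semi_innerC qc.1); exact: xe.
Qed.

(** Let w be the sum of the q (x_k) u x_k and S the left-hand side.  Then
    q u w = S, while almost orthogonality gives q w w <= 2 S; conclude by the
    Cauchy-Schwarz inequality. *)
Lemma bessel u : \sum_(k < N) q (x k) u ^+ 2 <= 2 * q u u.
Proof.
have [qS qn] := qc; have [_ _ qp] := qS; have e0' := e0.
pose s (k : 'I_N) := q (x k) u.
set S := \sum_(k < N) _.
have S0 : 0 <= S by apply: sumr_ge0 => k _; exact: sqr_ge0.
pose w := \sum_(k < N) s k *: x k.
have uw : q u w = S.
  rewrite semi_inner_sum//; apply: eq_bigr => k _.
  by rewrite (semi_innerC qS) expr2.
have ww : q w w <= 2 * S.
  have E : q w w = \sum_(k < N) \sum_(l < N) s k * (s l * q (x l) (x k)).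
    rewrite {2}/w semi_inner_sum//; apply: eq_bigr => k _.
    rewrite (semi_innerC qS) semi_inner_sum// mulr_sumr.
    by apply: eq_bigr => l _; rewrite (semi_innerC qS (x k)).
  have H (k l : 'I_N) : s k * (s l * q (x l) (x k)) <=
      (k == l)%:R * s l ^+ 2 + eps * ((s k ^+ 2 + s l ^+ 2) / 2).
    have [->|kl] := eqVneq k l.
      have : q (x l) (x l) <= 1.
        by apply: le_trans (qn _) _; rewrite expr_le1//; apply: x1.
      rewrite mul1r mulrA -expr2; have := sqr_ge0 (s l); have := qp (x l).
      move: (q _ _) (s l ^+ 2) => A B A0 B0 A1; nra.
    have : `|q (x l) (x k)| <= eps by apply: off_diagonal; rewrite // eq_sym.
    rewrite mul0r add0r ler_norml => /andP[h1 h2].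
    have := sqr_ge0 (s k - s l); have := sqr_ge0 (s k + s l).
    move: (q _ _) h1 h2 => A h1 h2.
    move: (s k) (s l) => a b; nra.
  rewrite E; apply: (@le_trans _ _
    (\sum_(k < N) (s k ^+ 2 + eps * ((N%:R * s k ^+ 2 + S) / 2)))).
    apply: ler_sum => k _; apply: le_trans (ler_sum _ (fun l _ => H k l)) _.
    rewrite big_split /= (bigD1 k)//= eqxx mul1r big1 ?addr0; last first.
      by move=> l lk; rewrite eq_sym (negbTE lk) mul0r.
    rewrite lerD2l -mulr_sumr ler_wpM2l// -mulr_suml ler_wpM2r//.
    by rewrite big_split /= sumr_const card_ord mulr_natl.
  rewrite big_split /= -mulr_sumr -mulr_suml big_split /= -mulr_sumr sumr_const card_ord.
  rewrite -[S *+ N]mulr_natl -/S.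
  have : eps * N%:R * S <= 1 * S by apply: ler_wpM2r.
  rewrite mul1r; lra.
have := semi_inner_CS qS u w; rewrite uw expr2 => h.
have [->|Sn0] := eqVneq S 0; first by have := qp u; lra.
have Sp : 0 < S by rewrite lt_def Sn0.
rewrite -(ler_pM2r Sp); apply: le_trans h _.
by have := ler_wpM2l (qp u) ww; lra.
Qed.

End Bessel.

(** The arithmetic-geometric mean inequality with weights b / a and a / b. *)
Lemma sum_mul_le (R : realType) n (f g : 'I_n -> R) a b : 0 <= a -> 0 <= b ->
  \sum_k f k ^+ 2 <= 2 * a ^+ 2 -> \sum_k g k ^+ 2 <= 2 * b ^+ 2 ->
  \sum_k `|f k| * `|g k| <= 2 * (a * b).
Proof.
have zero (h : 'I_n -> R) : \sum_k h k ^+ 2 <= 2 * 0 ^+ 2 -> forall k, h k = 0.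
  rewrite expr0n mulr0 => h0 k; apply/eqP; rewrite -sqrf_eq0 eq_le sqr_ge0 andbT.
  apply: le_trans h0; rewrite (bigD1 k)//= lerDl sumr_ge0// => i _.
  exact: sqr_ge0.
move=> a0 b0; have [->|an] := eqVneq a 0.
  by move=> /zero f0 _; rewrite big1 ?mul0r ?mulr0// => k _; rewrite f0 normr0 mul0r.
have [->|bn] := eqVneq b 0.
  by move=> _ /zero g0; rewrite big1 ?mulr0// => k _; rewrite g0 normr0 mulr0.
have ap : 0 < a by rewrite lt_def an.
have bp : 0 < b by rewrite lt_def bn.
move=> fa gb.
have ab : 0 <= b / a / 2 by rewrite !divr_ge0.
have ba : 0 <= a / b / 2 by rewrite !divr_ge0.
apply: (@le_trans _ _ (b / a / 2 * \sum_k f k ^+ 2 + a / b / 2 * \sum_k g k ^+ 2)).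
  rewrite !mulr_sumr -big_split; apply: ler_sum => k _ /=.
  rewrite -[f k ^+ 2]real_normK ?num_real// -[g k ^+ 2]real_normK ?num_real//.
  rewrite -subr_ge0.
  have -> : b / a / 2 * `|f k| ^+ 2 + a / b / 2 * `|g k| ^+ 2 - `|f k| * `|g k| =
     (b * `|f k| - a * `|g k|) ^+ 2 / (2 * a * b).
    by field; rewrite an bn.
  by rewrite divr_ge0 ?sqr_ge0// !mulr_ge0.
apply: le_trans (lerD (ler_wpM2l ab fa) (ler_wpM2l ba gb)) _.
rewrite le_eqVlt; apply/orP; left; apply/eqP; field.
by rewrite an bn.
Qed.

Section SimpleTensors.
Context (R : realType) (X Y : normedModType R).

Lemma simple_tensor (x : X) (y : Y) :
  exists z : tensor X Y, val z = elem_tensor x y.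
Proof.
have H : elem_tensor x y \in @tensor_pred R X Y.
  by rewrite inE; exists [:: (x, y)]; rewrite big_seq1.
by exists (Tensor H).
Qed.

Lemma bilin_form_le_proj_norm (z : tensor X Y) (b : bilin_form X Y) K :
  0 < K -> (forall x y, `|b x y| <= K * (`|x| * `|y|)) ->
  (val z) b <= K * proj_norm z.
Proof.
move=> K0 bK; rewrite -ler_pdivrMl//; apply: proj_norm_ge => s zs.
rewrite ler_pdivrMl// zs sum_elem_tensorE mulr_sumr; apply: ler_sum => i _.
exact: le_trans (ler_norm _) (bK _ _).
Qed.

(** The test form for the coefficients t is
    B(u, v) = sum_k sg(t_k) q(x_k, u) q'(y_k, v), of norm at most 2 by Bessel's
    inequality in both factors.  At x_i (x) y_i its i-th term times t_i is at least
    |t_i| / 4, while the others times t_i sum up to at most |t_i| / 8 in absolute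
    value. *)
Theorem proj_tensor_contains_l1 (N : nat) :
  ~ finite_dimensional X -> ~ finite_dimensional Y ->
  exists z : nat -> tensor X Y, (forall i, (i < N)%N -> proj_norm (z i) <= 1) /\
    forall t : nat -> R,
      \sum_(i < N) `|t i| <= 16 * proj_norm (\sum_(i < N) t i *: z i).
Proof.
move=> Xinf Yinf.
(* small enough for Bessel's inequality (eps N <= 1) and for the off-diagonal
   terms (eps N <= 1/8) *)
pose eps : R := (8 * N.+1%:R)^-1.
have N1 : 1 <= N.+1%:R :> R by rewrite ler1n.
have NN : N%:R <= N.+1%:R :> R by rewrite ler_nat.
have N0 : 0 <= N%:R :> R by [].
have e0 : 0 < eps by rewrite invr_gt0; lra.
have eE : eps * (8 * N.+1%:R) = 1 by rewrite mulVf// gt_eqF//; lra.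
have eN : eps * N%:R <= 1 / 8 by nra.
have e1 : eps <= 1 by nra.
have eN1 : eps * N%:R <= 1 by lra.
have [q [x [qc Hx]]] := dvoretzky_rogers N e0 (fun n => contractive_posdet n Xinf).
have [q' [y [q'c Hy]]] := dvoretzky_rogers N e0 (fun n => contractive_posdet n Yinf).
have x1 i : (i < N)%N -> `|x i| <= 1 by move=> /Hx[].
have y1 i : (i < N)%N -> `|y i| <= 1 by move=> /Hy[].
have xe i j : (i < N)%N -> (j < i)%N -> `|q (x i) (x j)| <= eps.
  by move=> /Hx[_ _]; exact.
have ye i j : (i < N)%N -> (j < i)%N -> `|q' (y i) (y j)| <= eps.
  by move=> /Hy[_ _]; exact.
have /choice[z zE] : forall i,
    exists z : tensor X Y, val z = elem_tensor (x i) (y i).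
  by move=> i; exact: simple_tensor.
exists z; split=> [i iN|t].
  apply: le_trans (@proj_norm_le _ _ _ _ [:: (x i, y i)] _) _.
    by rewrite big_seq1.
  by rewrite big_seq1 /= mulr_ile1 ?x1 ?y1.
pose B (u : X) (v : Y) : R^o :=
  \sum_(k < N) Num.sg (t k) * (q (x k) u * q' (y k) v).
have Bb : is_bilinear B.
  split=> [v a u1 u2|u a v1 v2].
    change (B (a *: u1 + u2) v = a * B u1 v + B u2 v).
    rewrite /B mulr_sumr -big_split; apply: eq_bigr => k _ /=.
    by have [[_ -> _] _] := qc; ring.
  change (B u (a *: v1 + v2) = a * B u v1 + B u v2).
  rewrite /B mulr_sumr -big_split; apply: eq_bigr => k _ /=.
  by have [[_ -> _] _] := q'c; ring.
have B2 u v : `|to_bilin_form Bb u v| <= 2 * (`|u| * `|v|).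
  apply: le_trans (ler_norm_sum _ _ _) _.
  apply: (@le_trans _ _ (\sum_(k < N) `|q (x k) u| * `|q' (y k) v|)).
    apply: ler_sum => k _; rewrite !normrM ler_piMl ?mulr_ge0//.
    by rewrite normr_sg; case: (_ != 0).
  apply: sum_mul_le => //.
    apply: le_trans (bessel qc x1 xe eN1 (ltW e0) u) _.
    by rewrite ler_wpM2l//; exact: qc.2.
  apply: le_trans (bessel q'c y1 ye eN1 (ltW e0) v) _.
  by rewrite ler_wpM2l//; exact: q'c.2.
have := bilin_form_le_proj_norm (\sum_(i < N) t i *: z i) (ltr0n _ 2) B2.
have -> : val (\sum_(i < N) t i *: z i) (to_bilin_form Bb) =
    \sum_(i < N) t i * B (x i) (y i).
  have E (r : seq 'I_N) : val (\sum_(i <- r) t i *: z i) (to_bilin_form Bb) =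
      \sum_(i <- r) t i * B (x i) (y i).
    elim: r => [|i r IH]; first by rewrite !big_nil.
    rewrite !big_cons -IH.
    by rewrite -[LHS]/(t i * val (z i) (to_bilin_form Bb) + _) zE.
  exact: E.
suff H i : (i < N)%N -> `|t i| / 8 <= t i * B (x i) (y i).
  have : \sum_(i < N) `|t i| / 8 <= \sum_(i < N) t i * B (x i) (y i).
    by apply: ler_sum => i _; exact: H.
  rewrite -mulr_suml; lra.
move=> iN; rewrite /B (bigD1 (Ordinal iN))//=.
rewrite mulrDr mulrA [t i * Num.sg _]mulrC -normrEsg.
have d : 1 / 4 <= q (x i) (x i) * q' (y i) (y i).
  have [_ hx _] := Hx i iN; have [_ hy _] := Hy i iN; nra.
have offd : `|t i * \sum_(k < N | k != Ordinal iN)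
    Num.sg (t k) * (q (x k) (x i) * q' (y k) (y i))|
    <= `|t i| / 8.
  rewrite normrM ler_wpM2l//; apply: le_trans (ler_norm_sum _ _ _) _.
  apply: (@le_trans _ _ (\sum_(k < N) eps)); last first.
    by rewrite sumr_const card_ord -[leLHS]mulr_natr; lra.
  rewrite [leRHS](bigID (fun k => k != Ordinal iN))/= -[leLHS]addr0.
  apply: lerD; last by apply: sumr_ge0 => k _; exact: ltW.
  apply: ler_sum => k ki.
  have kiN : (k : nat) != i by apply: contraNneq ki => ki; apply/eqP/val_inj.
  have h1 := off_diagonal qc xe (ltn_ord k) iN kiN.
  have h2 := off_diagonal q'c ye (ltn_ord k) iN kiN.
  rewrite !normrM; apply: (@le_trans _ _ (1 * (eps * 1))); last first.
    by rewrite mul1r mulr1.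
  apply: ler_pM; rewrite ?mulr_ge0//; first by rewrite normr_sg; case: (_ != 0).
  by apply: ler_pM => //; apply: le_trans e1.
move: offd; rewrite ler_norml => /andP[offd _].
have := ler_wpM2l (normr_ge0 (t i)) d; lra.
Qed.

End SimpleTensors.

(** * Uniform copies of l1 exclude superreflexivity *)

(** Polynomials serve as the space of finitely supported sequences, with 'X^j as
    j-th unit vector. *)
Section TailFunctionals.
Context (R : realType).
Implicit Type P : {poly R}.

Definition poly_l1 (N : nat) P : R := \sum_(i < N) `|P`_i|.

Lemma poly_l1_size N P : (size P <= N)%N -> poly_l1 N P = poly_l1 (size P) P.
Proof.
move=> sP; rewrite /poly_l1 (big_ord_widen _ (fun i => `|P`_i|) sP).
rewrite [LHS](bigID (fun i : 'I_N => (i < size P)%N))/=.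
rewrite [X in _ + X]big1 ?addr0// => i.
by rewrite -leqNgt => /(nth_default 0) ->; rewrite normr0.
Qed.

(** The sum of the coefficients of index at least k. *)
Definition tail_sum k P : R^o := (drop_poly k P).[1].

Lemma tail_sum_linear k : linear (tail_sum k).
Proof. by move=> a P Q; rewrite /tail_sum linearP hornerD hornerZ. Qed.

Lemma tail_sum_Xn k j : (k <= j)%N -> tail_sum k 'X^j = 1.
Proof.
move=> kj; rewrite /tail_sum -['X^j]mul1r drop_polyMXn (eqP kj) drop_poly0l mul1r.
by rewrite hornerXn expr1n.
Qed.

Lemma tail_sum_eq0 k P : (size P <= k)%N -> tail_sum k P = 0.
Proof. by move=> sP; rewrite /tail_sum drop_poly_eq0// horner0. Qed.

Lemma tail_sum_le k P : `|tail_sum k P| <= poly_l1 (size P) P.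
Proof.
rewrite /tail_sum horner_coef size_drop_poly.
apply: le_trans (ler_norm_sum _ _ _) _.
under eq_bigr do rewrite expr1n mulr1 coef_drop_poly.
have [kP|/ltnW Pk] := leqP k (size P); last first.
  by rewrite (eqP Pk) big_ord0 sumr_ge0.
rewrite /poly_l1 -(big_mkord xpredT (fun i => `|P`_i|)).
rewrite (@big_cat_nat _ _ _ k)//= -[leLHS]add0r lerD ?sumr_ge0//.
by rewrite (big_addn 0) big_mkord.
Qed.

End TailFunctionals.

Section UniformL1.
Context (R : realType) (V : completeNormedModType R) (C : R).
Hypothesis C0 : 0 < C.
Hypothesis l1V : forall N, exists z : nat -> V,
  (forall i, (i < N)%N -> `|z i| <= 1) /\
  forall t : nat -> R, \sum_(i < N) `|t i| <= C * `|\sum_(i < N) t i *: z i|.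

(** The tail sums are functionals bounded by C on the completion of the limit
    norm.  The bidual element f |-> lim_j f ('X^j) takes the value 1 at all of
    them, whereas their values at a fixed point tend to 0. *)
Theorem not_superreflexive_of_l1 : ~ superreflexive V.
Proof.
move=> srV; have /choice[z zP] := l1V.
have [U [UU FU]] := ultraFilterLemma eventually_filter.
pose T (N : nat) (P : {poly R}) : V := \sum_(i < N) P`_i *: z N i.
have TE N a P Q : T N (a *: P + Q) = a *: T N P + T N Q.
  rewrite /T scaler_sumr -big_split; apply: eq_bigr => i _.
  by rewrite coefD coefZ scalerDl scalerA.
have Tlin a P Q : \forall N \near U, T N (a *: P + Q) = a *: T N P + T N Q.
  by apply: filterE => N.
have Tup N P : `|T N P| <= poly_l1 N P.
  apply: le_trans (ler_norm_sum _ _ _) _; apply: ler_sum => i _.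
  by rewrite normrZ ler_piMr//; have [h _] := zP N; apply: h.
have Tlow N P : poly_l1 N P <= C * `|T N P| by have [_ h] := zP N; exact: h.
have largeN (P : {poly R}) : \forall N \near U, (size P <= N)%N.
  by apply: FU; exists (size P).
have [p pT] : exists p : seminorm {poly R}, forall P, `|T N P| @[N --> U] --> p P.
  apply: (limit_seminorm Tlin UU) => P; exists (poly_l1 (size P) P).
  by apply: filterS (largeN P) => N sP; rewrite -(poly_l1_size sP).
have plow (P : {poly R}) : poly_l1 (size P) P <= C * p P.
  have CT : C * `|T N P| @[N --> U] --> C * p P by exact: cvgMr (pT P).
  apply: (cvgr_to_ge CT); apply: filterS (largeN P) => N sP.
  by rewrite -(poly_l1_size sP).
have pXn j : p 'X^j <= 1.
  apply: (cvgr_to_le (pT 'X^j)); apply: filterS (largeN 'X^j) => N.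
  rewrite size_polyXn => jN; rewrite /T (bigD1 (Ordinal jN))//= coefXn eqxx scale1r.
  rewrite big1 ?addr0; first by have [h _] := zP N; apply: h.
  by move=> i ij; rewrite coefXn (_ : (_ == _) = false) ?scale0r//; apply: negbTE.
have refl : is_reflexive (completion p).
  by apply: srV; exact: (completion_finitely_representable Tlin _ pT).
pose W := completion p.
pose e j : W := completion_in p 'X^j.
have e1 j : `|e j| <= 1 by rewrite completion_in_norm.
pose Phi0 (f : dual_space W) : R := lim (f (e j) @[j --> U]).
have fe (f : dual_space W) j : `|f (e j)| <= `|f|.
  by apply: le_trans (dual_bound _ _) _; rewrite ler_piMr.
have Phicvg (f : dual_space W) : f (e j) @[j --> U] --> Phi0 f.
  have : cvg (f (e j) @[j --> U]); last by [].
  by apply: (ultra_bounded_cvg (M := `|f|)); apply: filterE => j; exact: fe.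
have [Phi PhiE] : exists Phi : dual_space (dual_space W), forall f, Phi f = Phi0 f.
  apply: mk_dual; split.
    move=> a f g; change (Phi0 (a *: f + g) = a * Phi0 f + Phi0 g).
    apply: cvg_lim => //.
    by apply: cvgD (Phicvg g); exact: cvgMr (Phicvg f).
  exists 1 => f; rewrite mul1r ler_norml; apply/andP; split.
    apply: (cvgr_to_ge (Phicvg f)); apply: filterE => j.
    by have := fe f j; rewrite ler_norml => /andP[].
  apply: (cvgr_to_le (Phicvg f)); apply: filterE => j.
  by have := fe f j; rewrite ler_norml => /andP[].
have [w wP] := refl Phi.
(* w is within 1 / (2 C) of a polynomial v, on which the tail sum from index
   size v vanishes, so that this functional is at most 1 / 2 at w *)
have d0 : 0 < (2 * C)^-1 by rewrite invr_gt0 mulr_gt0.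
have [v wv] := completion_in_dense w d0.
pose k := size v.
pose fk : {linear {poly R} -> R^o} :=
  HB.pack (tail_sum (R := R) k)
    (GRing.isLinear.Build R _ R^o *:%R _ (@tail_sum_linear R k)).
have fkp (P : {poly R}) : `|fk P| <= C * p P.
  exact: le_trans (tail_sum_le _ _) (plow P).
have [F [Fin FC]] := completion_extension (ltW C0) fkp.
have [f fE] : exists f : dual_space W, forall x, f x = F x.
  apply: mk_dual; split; last by exists C.
  by move=> a x y; rewrite linearP.
have f1 : Phi f = 1.
  rewrite PhiE; apply: cvg_lim => //.
  apply: (@cvg_trans _ ((fun=> 1 : R) @ U)); last exact: cvg_cst.
  apply: near_eq_cvg; apply: FU; exists k => // j /= kj.
  by rewrite fE Fin; apply/esym; exact: tail_sum_Xn.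
have fv : f (completion_in p v) = 0 by rewrite fE Fin; exact: tail_sum_eq0.
have : `|f w| <= 1 / 2.
  rewrite -[f w]subr0 -fv -dualB fE; apply: le_trans (FC _) _.
  have := ler_wpM2l (ltW C0) (ltW wv); rewrite invfM mulrCA divff ?gt_eqF// mulr1.
  by rewrite div1r.
by rewrite -wP f1 normr1; lra.
Qed.

End UniformL1.

Theorem theorem1p1 (R : realType) (X Y : completeNormedModType R)
    (superreflexiveX : superreflexive X) (superreflexiveY : superreflexive Y) :
  superreflexive (proj_tensor X Y) <->
  finite_dimensional X \/ finite_dimensional Y.
Proof.
split=> [srXY|[Xfin|Yfin]]; last 2 first.
- exact: superreflexive_proj_tensor_l.
- exact: superreflexive_proj_tensor_r.
apply: contrapT => /not_orP[Xinf Yinf].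
apply: (@not_superreflexive_of_l1 R _ 16) srXY => // N.
have [z [z1 zl1]] := proj_tensor_contains_l1 N Xinf Yinf.
exists (fun i => completion_in _ (z i)); split=> [i iN|t].
  by rewrite completion_in_norm; exact: z1.
apply: le_trans (zl1 t) _; rewrite ler_wpM2l//.
have -> : \sum_(i < N) t i *: completion_in (proj_seminorm X Y) (z i) =
    completion_in (proj_seminorm X Y) (\sum_(i < N) t i *: z i).
  by rewrite linear_sum; apply: eq_bigr => i _; rewrite linearZ.
by rewrite completion_in_norm.
Qed.
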